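(* Let $G$ and $H$ be finite nonempty connected graphs each having at least one edge, let $f\colon G\to H$ be a graph homomorphism, $v\in V(G)$, $w=f(v)$, $\Gamma=\pi_1^2(G,v)$, let $p_G\colon(\tilde G,\tilde v)\to(G,v)$, $p_H\colon(\tilde H,\tilde w)\to(H,w)$ be the universal 2-coverings and $\tilde f\colon(\tilde G,\tilde v)\to(\tilde H,\tilde w)$ the based lift of $f$. Then there is a short exact sequence of groups \[1\to\pi_1(\mathrm{Hom}^\Gamma(\tilde G,\tilde H)_{\tilde f},\tilde f)\to\pi_1(\mathrm{Hom}(G,H)_f,f)\to\Pi(f,v)\to 1.\]
   Context: Graphs: set $V(G)$ with symmetric $E(G)\subseteq V(G)\times V(G)$ (loops allowed). $N(x)$ is the neighborhood, $N^2(x)=\bigcup_{y\in N(x)}N(y)$. Walks, and the group $\pi_1^2(G,v)$: $\simeq_2$ on walks with fixed endpoints is generated by (A) $(x_0,\dots,x_m)\simeq_2(x_0,\dots,x_k,y,x_k,\dots,x_m)$ for $y$ adjacent to $x_k$ and (B) equal-length walks differing in at most one position; $\pi_1^2(G,v)$ is the group of classes of closed walks at $v$ under concatenation. A 2-covering map restricts to bijections $N(x)\to N(p(x))$ and $N^2(x)\to N^2(p(x))$ for all $x$; the universal 2-covering $p_G\colon(\tilde G,\tilde v)\to(G,v)$ is the connected based 2-covering with trivial $\pi_1^2(\tilde G,\tilde v)$. $\pi_1^2(G,v)$ acts on $\tilde G$: for $g=[\gamma]$ and $\tilde x$, choose a walk $\varphi$ from $\tilde v$ to $\tilde x$, lift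 $\gamma\cdot(p_G\circ\varphi)$ to a walk from $\tilde v$; $g\tilde x$ is its endpoint. Likewise $\pi_1^2(H,w)$ acts on $\tilde H$; $\Gamma$ acts on $\tilde H$ via $f_*$, and $\tilde f$ (the based homomorphism with $p_H\circ\tilde f=f\circ p_G$) is $\Gamma$-equivariant. Multi-homomorphisms $\eta\colon V(G)\to\mathcal{P}(V(H))\setminus\{\emptyset\}$ (edges map into $\eta(x)\times\eta(y)\subseteq E(H)$) form the poset $\mathrm{Hom}(G,H)$ (pointwise inclusion), topologized by the geometric realization of its order complex; a graph homomorphism $f$ is identified with $x\mapsto\{f(x)\}$, and $\mathrm{Hom}(G,H)_f$ is the component containing $f$. $\mathrm{Hom}^\Gamma(\tilde G,\tilde H)\subseteq\mathrm{Hom}(\tilde G,\tilde H)$ consists of $\eta$ with $\eta(g\tilde x)=f_*(g)\eta(\tilde x)$; $\mathrm{Hom}^\Gamma(\tilde G,\tilde H)_{\tilde f}$ is its component containing $\tilde f$. Realizable elements: $I_n$ has vertices $0,\dots,n$ with $i\sim j$ iff $|i-j|\le1$; $G\times I_n$ is the categorical product. A $\times$-homotopy from $f$ to $f$ is a graph homomorphism $h\colon G\times I_n\to H$ with $h(x,0)=h(x,n)=f(x)$. For $v'\in N_G(v)$, the closed walk $(h(v,0),h(v',0),h(v,1),h(v',1),\dots,h(v',n-1),h(v,n))$ at $w$ has a $\simeq_2$-class independent of $v'$, said to be realized by $h$. $\Pi(f,v)\subseteq\pi_1^2(H,w)$ is the subgroup of elements realized by some $\times$-homotopy from $f$ to $f$.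 *)

(* Defs.v *)
From HB Require Import structures.
From mathcomp Require Import all_boot all_order all_algebra finmap.
From mathcomp Require Import generic_quotient all_classical reals.
From mathcomp Require Import topology normedtype.
From mathcomp Require Import lra.
From Stdlib Require Import Relation_Operators.
Set Implicit Arguments.
Unset Strict Implicit.
Unset Printing Implicit Defensive.

Import Order.TTheory GRing.Theory Num.Theory.
Import numFieldTopology.Exports numFieldNormedType.Exports.

Local Open Scope classical_set_scope.
Local Open Scope quotient_scope.

Record graph := Graph {
  vertex :> choiceType;
  adj : rel vertex;
  adj_sym : symmetric adj }.

Section Neighborhoods.
Variable G : graph.

Definition nbrs (x : G) : set G := [set y | adj x y].
Definition nbrs2 (x : G) : set G := \bigcup_(y in nbrs x) nbrs y.

End Neighborhoods.

Record ghom (G H : graph) := GHom {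
  ghom_fun :> G -> H;
  ghom_adj : forall x y, adj x y -> adj (ghom_fun x) (ghom_fun y) }.

(* The walk (x, x_1, ..., x_m) is represented by the sequence x_1, ..., x_m. *)
Record walk (G : graph) (x y : G) := Walk {
  steps :> seq G;
  walkP : path (@adj G) x steps && (last x steps == y) }.

HB.instance Definition _ (G : graph) (x y : G) := [isSub for @steps G x y].
HB.instance Definition _ (G : graph) (x y : G) := [Choice of walk x y by <:].

Definition graph_connected (G : graph) := forall x y : G, inhabited (walk x y).

Definition finite_graph (G : graph) := finite_set [set: G].

Definition has_edge (G : graph) := exists x y : G, adj x y.

Section WalkOperations.
Variable G : graph.
Implicit Types x y z : G.

Lemma walk_path x y (c : walk x y) : path (@adj G) x c.
Proof. by case/andP: (walkP c). Qed.

Lemma walk_last x y (c : walk x y) : last x c = y.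
Proof. by case/andP: (walkP c) => _ /eqP. Qed.

Lemma nil_walk_subproof x : path (@adj G) x [::] && (last x [::] == x).
Proof. by rewrite /= eqxx. Qed.

Definition nil_walk x : walk x x := Walk (nil_walk_subproof x).

Lemma cat_walk_subproof x y z (c : walk x y) (d : walk y z) :
  path (@adj G) x (c ++ d) && (last x (c ++ d) == z).
Proof. by rewrite cat_path last_cat walk_last !walk_path walk_last eqxx. Qed.

Definition cat_walk x y z (c : walk x y) (d : walk y z) : walk x z :=
  Walk (cat_walk_subproof c d).

Lemma rev_walk_subproof x y (c : walk x y) :
  path (@adj G) y (rev (belast x c)) && (last y (rev (belast x c)) == x).
Proof.
have /= := @rev_path _ (@adj G) x c; rewrite walk_last => ->.
rewrite (eq_path (e' := @adj G)) ?walk_path /=; last first.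
  by move=> a b; rewrite adj_sym.
case: c => s /= /andP[_]; case: s => [|a s] /= e; first by rewrite eq_sym.
by rewrite rev_cons last_rcons.
Qed.

Definition rev_walk x y (c : walk x y) : walk y x := Walk (rev_walk_subproof c).

End WalkOperations.

Lemma map_walk_subproof (G H : graph) (f : ghom G H) (x y : G) (c : walk x y) :
  path (@adj H) (f x) (map f c) && (last (f x) (map f c) == f y).
Proof.
rewrite last_map walk_last eqxx andbT path_map.
by apply: sub_path (walk_path c) => a b; exact: ghom_adj.
Qed.

Definition map_walk (G H : graph) (f : ghom G H) (x y : G) (c : walk x y) :
  walk (f x) (f y) := Walk (map_walk_subproof f c).

Section TwoFundamentalGroup.
Variable G : graph.
Implicit Types x y z : G.

(* In walk_move_spur, t is adjacent to z because d is a walk.  In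
   walk_move_vertex, the moved vertex is an inner one (or z = t) because c and d
   have the same end points. *)
Inductive walk_move x y (c d : walk x y) : Prop :=
| walk_move_spur p z t q of
    x :: c = p ++ z :: q & x :: d = p ++ [:: z, t, z & q]
| walk_move_vertex p z t q of
    x :: c = p ++ z :: q & x :: d = p ++ t :: q.

Definition walk_equiv x y : walk x y -> walk x y -> Prop :=
  clos_refl_sym_trans _ (@walk_move x y).

Definition walk_equivb x y : rel (walk x y) := fun c d => `[< walk_equiv c d >].

Lemma walk_equivb_refl x y : reflexive (@walk_equivb x y).
Proof. by move=> c; apply/asboolP/rst_refl. Qed.

Lemma walk_equivb_sym x y : symmetric (@walk_equivb x y).
Proof.
by move=> c d; apply/idP/idP => /asboolP cd; apply/asboolP; apply: rst_sym.
Qed.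

Lemma walk_equivb_trans x y : transitive (@walk_equivb x y).
Proof.
by move=> c d e /asboolP dc /asboolP ce; apply/asboolP/(rst_trans _ _ _ _ _ dc).
Qed.

Canonical walk_equiv_equiv x y := EquivRel (@walk_equivb x y)
  (@walk_equivb_refl x y) (@walk_equivb_sym x y) (@walk_equivb_trans x y).

Lemma cat_walk_equiv x y z (c c' : walk x y) (d d' : walk y z) :
  walk_equiv c c' -> walk_equiv d d' ->
  walk_equiv (cat_walk c d) (cat_walk c' d').
Proof.
move=> cc' dd'; apply: (rst_trans _ _ _ (cat_walk c' d)).
  elim: cc' => {c c'} [c c' m|c|c c' _|c c' c'' _ m1 _ m2].
  - by apply: rst_step; case: m => p u t q e e';
      [apply: (@walk_move_spur _ _ _ _ p u t (q ++ d))
      |apply: (@walk_move_vertex _ _ _ _ p u t (q ++ d))];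
      rewrite /= -cat_cons ?e ?e' -catA.
  - exact: rst_refl.
  - exact: rst_sym.
  - exact: rst_trans m1 m2.
elim: dd' => {d d'} [d d' m|d|d d' _|d d' d'' _ m1 _ m2].
- have ce : x :: c' = rcons (belast x c') y by rewrite lastI walk_last.
  by apply: rst_step; case: m => p u t q e e';
    [apply: (@walk_move_spur _ _ _ _ (belast x c' ++ p) u t q)
    |apply: (@walk_move_vertex _ _ _ _ (belast x c' ++ p) u t q)];
    rewrite /= -cat_cons ce cat_rcons ?e ?e' -?catA.
- exact: rst_refl.
- exact: rst_sym.
- exact: rst_trans m1 m2.
Qed.

Lemma rev_walkVl x y (c : walk x y) :
  walk_equiv (cat_walk (rev_walk c) c) (nil_walk y).
Proof.
suff H : forall s z (e : z = y) (w : walk y y),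
    path (@adj G) x s -> last x s = y -> steps w = rev (belast x s) ++ s ->
    walk_equiv w (nil_walk y).
  exact: (H c y erefl _ (walk_path c) (walk_last c)).
move=> s _ _ w + + ; elim: s w x {c} => [|a s IHs] w x /=.
  move=> _ xy ws; have -> : w = nil_walk y by apply: val_inj.
  exact: rst_refl.
move=> /andP[xa pas] ly ws.
have w'P : path (@adj G) y (rev (belast a s) ++ s) &&
    (last y (rev (belast a s) ++ s) == y).
  have cP : path (@adj G) a s && (last a s == y) by rewrite pas ly eqxx.
  exact: (cat_walk_subproof (rev_walk (Walk cP)) (Walk cP)).
apply: (rst_trans _ _ _ (Walk w'P)); last exact: (IHs _ a).
apply/rst_sym/rst_step.
have E : exists p, y :: rev (belast a s) = rcons p a.
  exists (rev s); rewrite -rev_cons -rev_rcons; congr rev.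
  by rewrite -ly -lastI.
case: E => p E; apply: (@walk_move_spur _ _ _ _ p a x s).
  by rewrite /= -cat_cons E cat_rcons.
rewrite ws /= rev_cons cat_rcons -cat_cons E.
by rewrite cat_rcons.
Qed.

Definition pi12 (v : G) : Type := {eq_quot @walk_equivb v v}.

HB.instance Definition _ v := Choice.on (pi12 v).

Definition pi12_class v (c : walk v v) : pi12 v := \pi_({eq_quot @walk_equivb v v}) c.

Definition pi12_repr v (a : pi12 v) : walk v v :=
  repr (a : {eq_quot @walk_equivb v v}).

Lemma pi12_reprK v : cancel (@pi12_repr v) (@pi12_class v).
Proof. exact: reprK. Qed.

Lemma pi12_classP v (c d : walk v v) :
  pi12_class c = pi12_class d <-> walk_equiv c d.
Proof.
split => [/eqquotP|] ; first by move/asboolP.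
by move=> cd; apply/eqquotP/asboolP.
Qed.

Definition pi12_mul v (a b : pi12 v) : pi12 v :=
  pi12_class (cat_walk (pi12_repr a) (pi12_repr b)).
Definition pi12_one v : pi12 v := pi12_class (nil_walk v).
Definition pi12_inv v (a : pi12 v) : pi12 v :=
  pi12_class (rev_walk (pi12_repr a)).

Lemma pi12_mulE v (c d : walk v v) :
  pi12_mul (pi12_class c) (pi12_class d) = pi12_class (cat_walk c d).
Proof. by apply/pi12_classP/cat_walk_equiv; apply/pi12_classP; exact: pi12_reprK. Qed.

Lemma pi12_mulA v : associative (@pi12_mul v).
Proof.
move=> a b c; rewrite -(pi12_reprK a) -(pi12_reprK b) -(pi12_reprK c).
by rewrite !pi12_mulE; congr pi12_class; apply: val_inj; rewrite /= catA.
Qed.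

Lemma pi12_mul1 v : left_id (pi12_one v) (@pi12_mul v).
Proof.
by move=> a; rewrite -(pi12_reprK a) pi12_mulE; congr pi12_class; apply: val_inj.
Qed.

Lemma pi12_mulr1 v : right_id (pi12_one v) (@pi12_mul v).
Proof.
move=> a; rewrite -(pi12_reprK a) pi12_mulE; congr pi12_class; apply: val_inj.
by rewrite /= cats0.
Qed.

Lemma pi12_mulV v : left_inverse (pi12_one v) (@pi12_inv v) (@pi12_mul v).
Proof.
move=> a; rewrite -{2}(pi12_reprK a) pi12_mulE.
exact/pi12_classP/rev_walkVl.
Qed.

Lemma pi12_mulrV v : right_inverse (pi12_one v) (@pi12_inv v) (@pi12_mul v).
Proof.
move=> a; rewrite -{1}(pi12_reprK a) pi12_mulE.
apply/pi12_classP; set c := pi12_repr a.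
suff {1}-> : c = rev_walk (rev_walk c) by exact: rev_walkVl.
apply: val_inj => /=; case: c => s /= /andP[_ /eqP lv].
have : v :: rev (belast v s) = rev (v :: s).
  by rewrite [v :: s in RHS]lastI rev_rcons lv.
move/(congr1 (fun t => rev (belast v (behead t)))) => /= ->.
case/lastP: s lv => [|s z] //= ; rewrite last_rcons => ->.
by rewrite rev_cons rev_rcons /= belast_rcons rev_cons revK.
Qed.

HB.instance Definition _ v := isGroup.Build (pi12 v)
  (@pi12_mulA v) (@pi12_mul1 v) (@pi12_mulr1 v) (@pi12_mulV v) (@pi12_mulrV v).

End TwoFundamentalGroup.

Definition pi12_map (G H : graph) (f : ghom G H) (v : G) (a : pi12 v) :
  pi12 (f v) := pi12_class (map_walk f (pi12_repr a)).

Lemma map_walk_equiv (G H : graph) (f : ghom G H) (x y : G) (c d : walk x y) :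
  walk_equiv c d -> walk_equiv (map_walk f c) (map_walk f d).
Proof.
elim=> {c d} [c d m|c|c d _|c d e _ m1 _ m2].
- by apply: rst_step; case: m => p u t q ec ed;
    [apply: (@walk_move_spur _ _ _ _ _ (map f p) (f u) (f t) (map f q))
    |apply: (@walk_move_vertex _ _ _ _ _ (map f p) (f u) (f t) (map f q))];
    rewrite /= -map_cons ?ec ?ed map_cat.
- exact: rst_refl.
- exact: rst_sym.
- exact: rst_trans m1 m2.
Qed.

Lemma pi12_mapE (G H : graph) (f : ghom G H) (v : G) (c : walk v v) :
  pi12_map f (pi12_class c) = pi12_class (map_walk f c).
Proof.
by apply/pi12_classP/map_walk_equiv/pi12_classP; exact: pi12_reprK.
Qed.

Definition covering2 (G H : graph) (p : ghom G H) :=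
  forall x : G, set_bij (nbrs x) (nbrs (p x)) p /\
                set_bij (nbrs2 x) (nbrs2 (p x)) p.

Record ucover2 (G : graph) (v : G) := UCover2 {
  ucover :> graph;
  uproj : ghom ucover G;
  ubase : ucover;
  uproj_base : uproj ubase = v;
  uproj_covering : covering2 uproj;
  ucover_connected : graph_connected ucover;
  ucover_pi12 : forall a : pi12 ubase, a = 1%g }.

Arguments uproj {G v} _.
Arguments ubase {G v} _.

Record based_lift (G H : graph) (f : ghom G H) (v : G)
    (pG : ucover2 v) (pH : ucover2 (f v)) := BasedLift {
  lift_hom :> ghom pG pH;
  lift_comm : forall x : pG, uproj pH (lift_hom x) = f (uproj pG x);
  lift_base : lift_hom (ubase pG) = ubase pH }.

Arguments based_lift {G H} f {v} pG pH.

Section DeckAction.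
Variables (G : graph) (v : G) (p : ucover2 v).
Implicit Types (g : pi12 v) (x y : p).

(* y is the endpoint of the lift l, starting at the base point, of the walk
   c followed by the projection of phi *)
Definition deck_rel g x y : Prop :=
  exists (c : walk v v) (phi : walk (ubase p) x) (l : walk (ubase p) y),
    pi12_class c = g /\ map (uproj p) l = c ++ map (uproj p) phi.

(* deck_rel g is the graph of a function (deck_rel_exists, deck_rel_inj): the default
   value x of xget is never used. *)
Definition deck g x : p := xget x [set y | deck_rel g x y].

Lemma lift_walk x (s : seq G) : path (@adj G) (uproj p x) s ->
  exists2 l : seq p, path (@adj p) x l & map (uproj p) l = s.
Proof.
elim: s x => [|a s IHs] x /=; first by exists [::].
move=> /andP[xa pas]; have [_ _ sN] := (uproj_covering x).1.
have [b xb ba] := sN a xa; subst a; have [l pl <-] := IHs _ pas.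
by exists (b :: l) => //=; rewrite pl andbT.
Qed.

Lemma adj_inj x y z : adj x y -> adj x z -> uproj p y = uproj p z -> y = z.
Proof.
move=> xy xz; have [_ iN _] := (uproj_covering x).1.
by apply: iN; rewrite inE.
Qed.

Lemma lift_uniq x (l l' : seq p) : path (@adj p) x l -> path (@adj p) x l' ->
  map (uproj p) l = map (uproj p) l' -> l = l'.
Proof.
elim: l l' x => [|a l IHl] [|b l'] x //= /andP[xa pl] /andP[xb pl'] [ab e].
have ba := adj_inj xa xb ab; rewrite -ba in pl' *; congr cons.
exact: IHl pl pl' e.
Qed.

Definition lift_end x (s : seq G) y := exists l : seq p,
  [/\ path (@adj p) x l, map (uproj p) l = s & last x l = y].

Lemma lift_end_inj x s y z : lift_end x s y -> lift_end x s z -> y = z.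
Proof.
by move=> [l [pl <- <-]] [l' [pl' /esym e <-]]; rewrite (lift_uniq pl pl' e).
Qed.

Lemma lift_end_exists x (s : seq G) : path (@adj G) (uproj p x) s ->
  exists y, lift_end x s y.
Proof. by move=> /lift_walk[l pl ls]; exists (last x l), l. Qed.

Lemma lift_end_cat x (s t : seq G) z : lift_end x (s ++ t) z <->
  exists2 y, lift_end x s y & lift_end y t z.
Proof.
split=> [[l [pl ls <-]]|[y [l [pl <- <-]] [l' [pl' <- <-]]]]; last first.
  by exists (l ++ l'); rewrite cat_path pl pl' map_cat last_cat.
move: pl; rewrite -{1 2}(cat_take_drop (size s) l) cat_path => /andP[pt pd].
have ts : map (uproj p) (take (size s) l) = s by rewrite map_take ls take_size_cat.
have ds : map (uproj p) (drop (size s) l) = t by rewrite map_drop ls drop_size_cat.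
exists (last x (take (size s) l)); first by exists (take (size s) l).
by exists (drop (size s) l); split=> //; rewrite -last_cat cat_take_drop.
Qed.

Lemma lift_end_proj x s y : lift_end x s y -> last (uproj p x) s = uproj p y.
Proof. by move=> [l [_ <- <-]]; rewrite last_map. Qed.

Lemma lift_end_move x (b : G) (c d : walk (uproj p x) b) y :
  walk_move c d -> lift_end x c y <-> lift_end x d y.
Proof.
suff H (c' d' : walk (uproj p x) b) z : walk_move c' d' ->
    lift_end x c' z -> lift_end x d' z.
  move=> cd; split; first exact: H.
  move=> dy; have [z cz] := lift_end_exists (walk_path c).
  by rewrite (lift_end_inj dy (H _ _ _ cd cz)).
have dP := walk_path d'; have cl := walk_last c'; have dl := walk_last d'.
case=> [s u t q ec ed|[|e s] u t q]; last 2 first.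
- by move=> /= [_ ->] [_ ->].
- move=> /= [_ ec] [_ ed]; rewrite ec ed => /lift_end_cat[y1 sy1 uq].
  apply/lift_end_cat; exists y1 => //.
  case: q => [|n q] in ec ed uq *.
    by move: cl dl; rewrite ec ed !last_cat /= => cl dl; rewrite dl -cl.
  move: dP; rewrite ed cat_path (lift_end_proj sy1) => /andP[_ /= /and3P[y1t tn _]].
  move: uq; rewrite -[u :: _]/([:: u; n] ++ q) -[t :: _]/([:: t; n] ++ q).
  move=> /lift_end_cat[y2 [l [pl lun <-]] qz]; apply/lift_end_cat; exists (last y1 l) => //.
  have tnP : path (@adj G) (uproj p y1) [:: t; n] by rewrite /= y1t tn.
  have [l' pl' ltn] := lift_walk tnP; exists l'; split=> //.
  case: l pl lun {qz} => [|u1 [|n1 []]] //= /and3P[y1u1 u1n1 _] [u1u n1n].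
  case: l' pl' ltn => [|t2 [|n2 []]] //= /and3P[y1t2 t2n2 _] [t2t n2n].
  have [_ iN2 _] := (uproj_covering y1).2.
  by apply: iN2; rewrite ?inE ?n1n ?n2n //; [exists t2|exists u1].
have [p0 ep0] : exists p0, rcons s u = uproj p x :: p0.
  case: s ec {ed} => [|e s] /= [e1 _]; [exists [::]|exists (rcons s u)];
  by rewrite /= e1.
have lp0 : last (uproj p x) p0 = u by rewrite -(last_rcons u s u) ep0.
move: ec ed; rewrite -2!(cat_rcons u s) ep0 /= => -[ec] [ed].
rewrite ec ed => /lift_end_cat[y1 sy1 qz]; apply/lift_end_cat; exists y1 => //.
have y1u : uproj p y1 = u by rewrite -(lift_end_proj sy1) lp0.
move: dP; rewrite ed cat_path lp0 => /andP[_ /= /and3P[ut _ _]].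
rewrite -[t :: _]/([:: t; u] ++ q); apply/lift_end_cat; exists y1 => //.
have tP : path (@adj G) (uproj p y1) [:: t] by rewrite y1u /= ut.
have [l pl lt] := lift_walk tP.
case: l pl lt => [|b1 []] //= /andP[y1b1 _] [b1t].
by exists [:: b1; y1]; rewrite /= y1b1 adj_sym y1b1 b1t y1u.
Qed.

Lemma lift_end_equiv x (b : G) (c d : walk (uproj p x) b) y :
  walk_equiv c d -> lift_end x c y <-> lift_end x d y.
Proof.
elim=> {c d} [c d m|c|c d _ [cd dc]|c d e _ [cd dc] _ [de ed]].
- exact: lift_end_move.
- by [].
- by split.
- by split=> [/cd/de|/ed/dc].
Qed.

Lemma ucover_walk_equiv x (phi psi : walk (ubase p) x) : walk_equiv phi psi.
Proof.
have pp : walk_equiv (cat_walk psi (rev_walk psi)) (nil_walk _).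
  apply/pi12_classP.
  exact: etrans (ucover_pi12 _) (esym (ucover_pi12 _)).
have qq : walk_equiv (cat_walk phi (rev_walk psi)) (nil_walk _).
  apply/pi12_classP.
  exact: etrans (ucover_pi12 _) (esym (ucover_pi12 _)).
have h1 : walk_equiv (cat_walk phi (cat_walk (rev_walk psi) psi)) phi.
  apply: (rst_trans _ _ _ (cat_walk phi (nil_walk _))).
    by apply: cat_walk_equiv; [exact: rst_refl|exact: rev_walkVl].
  have -> : cat_walk phi (nil_walk _) = phi by apply: val_inj; rewrite /= cats0.
  exact: rst_refl.
apply: rst_trans (rst_sym _ _ _ _ h1) _.
have -> : cat_walk phi (cat_walk (rev_walk psi) psi) =
          cat_walk (cat_walk phi (rev_walk psi)) psi.
  by apply: val_inj; rewrite /= catA.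
have psiE : cat_walk (nil_walk _) psi = psi by apply: val_inj.
suff: walk_equiv (cat_walk (cat_walk phi (rev_walk psi)) psi)
    (cat_walk (nil_walk _) psi) by rewrite psiE.
by apply: cat_walk_equiv; [exact: qq|exact: rst_refl].
Qed.

Lemma deck_rel_exists g x : exists y, deck_rel g x y.
Proof.
have [phi] := ucover_connected (ubase p) x.
pose c := pi12_repr g.
have cphiP : path (@adj G) (uproj p (ubase p)) (c ++ map (uproj p) phi).
  have := walk_path (map_walk (uproj p) phi); have := walk_path c.
  by rewrite /= uproj_base cat_path walk_last => -> ->.
have [l pl lE] := lift_walk cphiP.
have lP : path (@adj p) (ubase p) l && (last (ubase p) l == last (ubase p) l).
  by rewrite pl eqxx.
by exists (last (ubase p) l), c, phi, (Walk lP); rewrite pi12_reprK.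
Qed.

Lemma deck_rel_inj g x y z : deck_rel g x y -> deck_rel g x z -> y = z.
Proof.
move=> [c [phi [l [cg el]]]] [d [psi [l' [dg el']]]].
have cd : walk_equiv c d by apply/pi12_classP; rewrite cg dg.
have pE : uproj p (ubase p) = v := uproj_base p.
have H (v' : G) (e : v' = v) (a b : walk v v) (f1 f2 : walk v' (uproj p x)) :
    walk_equiv a b -> walk_equiv f1 f2 ->
    exists2 w : walk v' (uproj p x) * walk v' (uproj p x),
      walk_equiv w.1 w.2 & steps w.1 = a ++ f1 /\ steps w.2 = b ++ f2.
  subst v' => ab f12; exists (cat_walk a f1, cat_walk b f2) => //=.
  exact: cat_walk_equiv.
have [[w1 w2] /= w12 [ew1 ew2]] := H _ pE _ _ _ _ cd
  (map_walk_equiv (uproj p) (ucover_walk_equiv phi psi)).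
have w1y : lift_end (ubase p) w1 y.
  by exists l; rewrite walk_path walk_last ew1.
have w2z : lift_end (ubase p) w2 z.
  by exists l'; rewrite walk_path walk_last ew2.
exact: lift_end_inj ((lift_end_equiv y w12).1 w1y) w2z.
Qed.

Lemma deckP g x : deck_rel g x (deck g x).
Proof. exact: (xgetPex x (deck_rel_exists g x)). Qed.

Lemma deckE g x y : deck_rel g x y -> deck g x = y.
Proof. exact: deck_rel_inj (deckP g x). Qed.

End DeckAction.

Lemma lift_equivariant (G H : graph) (f : ghom G H) (v : G)
    (pG : ucover2 v) (pH : ucover2 (f v)) (ft : based_lift f pG pH)
    (g : pi12 v) (x : pG) :
  ft (deck g x) = deck (pi12_map f g) (ft x).
Proof.
apply/esym/deckE; have [c [phi [l [cg el]]]] := deckP g x.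
have B z (w : walk (ubase pG) z) : path (@adj pH) (ubase pH) (map ft w) &&
    (last (ubase pH) (map ft w) == ft z).
  by have := walkP (map_walk ft w); rewrite /= lift_base.
have M (s : seq pG) : map (uproj pH) (map ft s) = map f (map (uproj pG) s).
  by elim: s => //= z s ->; rewrite lift_comm.
exists (map_walk f c), (Walk (B _ phi)), (Walk (B _ l)); split.
  by rewrite -cg pi12_mapE.
by rewrite [steps _]/= [steps (Walk (B _ phi))]/= !M el map_cat.
Qed.

Definition is_multihom (G H : graph) (eta : G -> set H) : Prop :=
  (forall x, eta x !=set0) /\
  (forall x y, adj x y -> forall a b, eta x a -> eta y b -> adj a b).

Record multihom (G H : graph) := MultiHom {
  mhom_fun : G -> set H;
  mhomP : `[< is_multihom mhom_fun >] }.

HB.instance Definition _ (G H : graph) := [isSub for @mhom_fun G H].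
HB.instance Definition _ (G H : graph) := [Choice of multihom G H by <:].
(* The order inherited from G -> set H is pointwise inclusion: multihom_leP. *)
HB.instance Definition _ (G H : graph) :=
  [SubChoice_isSubPOrder of multihom G H by <: with Order.default_display].

Coercion mhom_fun : multihom >-> Funclass.

Lemma multihom_leP (G H : graph) (eta theta : multihom G H) :
  reflect (forall x, eta x `<=` theta x) (eta <= theta)%O.
Proof.
by rewrite leEsub; apply: (iffP (lefP _ _)) => le x; have := le x;
  rewrite subsetEset.
Qed.

Lemma multihom_of_subproof (G H : graph) (f : ghom G H) :
  `[< is_multihom (fun x => [set f x]) >].
Proof.
apply/asboolP; split=> [x|x y xy a b -> ->]; first by exists (f x).
exact: ghom_adj.
Qed.

Definition multihom_of (G H : graph) (f : ghom G H) : multihom G H :=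
  MultiHom (multihom_of_subproof f).

Definition is_equivariant (G H : graph) (f : ghom G H) (v : G)
    (pG : ucover2 v) (pH : ucover2 (f v)) (eta : multihom pG pH) : Prop :=
  forall (g : pi12 v) (x : pG),
    eta (deck g x) = [set deck (pi12_map f g) y | y in eta x].

Record equiv_multihom (G H : graph) (f : ghom G H) (v : G)
    (pG : ucover2 v) (pH : ucover2 (f v)) := EquivMultiHom {
  equiv_mhom :> multihom pG pH;
  equiv_mhomP : `[< is_equivariant equiv_mhom >] }.

Arguments equiv_multihom {G H} f {v} pG pH.

HB.instance Definition _ (G H : graph) (f : ghom G H) (v : G)
    (pG : ucover2 v) (pH : ucover2 (f v)) :=
  [isSub for @equiv_mhom G H f v pG pH].
HB.instance Definition _ (G H : graph) (f : ghom G H) (v : G)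
    (pG : ucover2 v) (pH : ucover2 (f v)) :=
  [Choice of equiv_multihom f pG pH by <:].
HB.instance Definition _ (G H : graph) (f : ghom G H) (v : G)
    (pG : ucover2 v) (pH : ucover2 (f v)) :=
  [SubChoice_isSubPOrder of equiv_multihom f pG pH by <:
    with Order.default_display].

Lemma equiv_multihom_of_subproof (G H : graph) (f : ghom G H) (v : G)
    (pG : ucover2 v) (pH : ucover2 (f v)) (ft : based_lift f pG pH) :
  `[< is_equivariant (multihom_of ft) >].
Proof. by apply/asboolP => g x; rewrite /= image_set1 lift_equivariant. Qed.

Definition equiv_multihom_of (G H : graph) (f : ghom G H) (v : G)
    (pG : ucover2 v) (pH : ucover2 (f v)) (ft : based_lift f pG pH) :
    equiv_multihom f pG pH :=
  EquivMultiHom (equiv_multihom_of_subproof ft).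

Section Realization.
Local Open Scope ring_scope.
Local Open Scope fset_scope.
Variables (R : realType) (P : choiceType) (K : set {fset P}).

Definition in_simplex (s : {fset P}) (t : P -> R) : Prop :=
  [/\ forall x, 0 <= t x,
      forall x, x \notin s -> t x = 0 &
      \sum_(x <- s) t x = 1].

(* Points are represented by their barycentric coordinates. *)
Record realization := Realization {
  coord :> P -> R;
  coordP : `[< exists2 s, K s & in_simplex s coord >] }.

HB.instance Definition _ := [isSub for coord].
HB.instance Definition _ := [Choice of realization by <:].

(* Weak topology: U is open when it meets every simplex s of K in a relatively
   open subset, for the (Euclidean) topology given by the coordinates. *)
Definition realization_open : set_system realization :=
  [set U | forall s, K s -> forall t : realization, in_simplex s t -> U t ->
    exists2 e : R, 0 < e & forall u : realization, in_simplex s u ->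
      (forall x, `|t x - u x| < e) -> U u].

Lemma realization_openT : realization_open setT.
Proof. by move=> s _ t _ _; exists 1. Qed.

Lemma realization_openI : setI_closed realization_open.
Proof.
move=> U V oU oV s Ks t st [Ut Vt].
have [e e0 eU] := oU _ Ks _ st Ut; have [d d0 dV] := oV _ Ks _ st Vt.
exists (Num.min e d); first by rewrite lt_min e0 d0.
move=> u su tu; split; [apply: eU => // x|apply: dV => // x];
  by have := tu x; rewrite lt_min => /andP[].
Qed.

Lemma realization_open_bigU (I : Type) (F : I -> set realization) :
  (forall i, realization_open (F i)) -> realization_open (\bigcup_i F i).
Proof.
move=> oF s Ks t st [i _ Fit]; have [e e0 eF] := oF i _ Ks _ st Fit.
by exists e => // u su tu; exists i => //; exact: eF.
Qed.

HB.instance Definition _ := isOpenTopological.Build realization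
  realization_openT realization_openI realization_open_bigU.

End Realization.

Section OrderComplex.
Local Open Scope ring_scope.
Variables (d : Order.disp_t) (P : porderType d).

Definition order_complex : set {fset P} :=
  [set s | s != fset0 /\ {in s &, forall x y, (x >=< y)%O}].

Lemma order_complex_point_subproof (R : realType) (x : P) :
  `[< exists2 s, order_complex s &
        in_simplex s (fun y : P => (y == x)%:R : R) >].
Proof.
apply/asboolP; exists [fset x]%fset.
  split; first by apply/fset0Pn; exists x; rewrite inE.
  by move=> y z; rewrite !inE => /eqP-> /eqP->; exact: comparablexx.
split=> [y|y|]; first exact: ler0n.
  by rewrite inE => /negbTE->.
by rewrite big_seq_fset1 eqxx.
Qed.

Definition order_complex_point (R : realType) (x : P) :
    realization R order_complex :=
  Realization (order_complex_point_subproof R x).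

End OrderComplex.

Section Components.
Variable X : topologicalType.

(* set_type carries the subspace topology *)
Definition component (x : X) : topologicalType :=
  set_type (connected_component [set: X] x).

Lemma component_point_subproof (x : X) :
  x \in connected_component [set: X] x.
Proof. by apply/mem_set/connected_component_refl. Qed.

Definition component_point (x : X) : component x :=
  exist _ x (component_point_subproof x).

End Components.

Section WithinContinuity.
Context {T U V : topologicalType}.

Lemma within_comp (A : set T) (B : set U) (f : T -> U) (g : U -> V) :
  {within A, continuous f} -> (forall x, A x -> B (f x)) ->
  {within B, continuous g} -> {within A, continuous (g \o f)}.
Proof.
move=> /subspace_continuousP cf AB /subspace_continuousP cg.
apply/subspace_continuousP => x Ax W /(cg _ (AB _ Ax)) gW.
have := cf _ Ax _ gW; rewrite /within /nbhs /=.
by apply: filterS => y + Ay; apply => //; exact: AB.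
Qed.

Lemma within_eq (A : set T) (f g : T -> U) :
  (forall x, A x -> f x = g x) -> {within A, continuous f} ->
  {within A, continuous g}.
Proof.
by move=> fg; apply: subspace_eq_continuous => x /set_mem; exact: fg.
Qed.

End WithinContinuity.

Section FundamentalGroup.
Local Open Scope ring_scope.
Variables (R : realType) (X : topologicalType).

Local Notation I := (`[0, 1]%classic : set R).

Lemma unitP (t : R) : reflect (0 <= t /\ t <= 1) (t \in `[0, 1]).
Proof. by rewrite in_itv /=; exact: andP. Qed.

Definition is_loop (x : X) (c : R -> X) : Prop :=
  [/\ {within I, continuous c}, c 0 = x & c 1 = x].

Record loop (x : X) := Loop {
  loop_fun :> R -> X;
  loopP : `[< is_loop x loop_fun >] }.

HB.instance Definition _ (x : X) := [isSub for @loop_fun x].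
HB.instance Definition _ (x : X) := [Choice of loop x by <:].

Definition homotopic (x : X) (c d : R -> X) : Prop :=
  exists F : R * R -> X,
    [/\ {within I `*` I, continuous F},
        forall t, I t -> F (0, t) = c t,
        forall t, I t -> F (1, t) = d t &
        forall s, I s -> F (s, 0) = x /\ F (s, 1) = x].

Lemma continuous_pair (T U V : topologicalType) (f : T -> U) (g : T -> V) :
  continuous f -> continuous g -> continuous (fun z => (f z, g z)).
Proof. by move=> cf cg z; apply: cvg_pair; [exact: cf|exact: cg]. Qed.

Lemma continuous_affine (T : topologicalType) (f : T -> R) (a b : R) :
  continuous f -> continuous (fun z => a * f z + b).
Proof.
move=> cf z; apply: cvgD; last exact: cvg_cst.
by apply: cvgM; [exact: cvg_cst|exact: cf].
Qed.

Lemma continuous_fst (S T : topologicalType) : continuous (@fst S T).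
Proof. by move=> z; exact: cvg_fst. Qed.

Lemma continuous_snd (S T : topologicalType) : continuous (@snd S T).
Proof. by move=> z; exact: cvg_snd. Qed.

Lemma square_split1 : I `*` I =
  ((I `*` I) `&` [set z : R * R | z.1 <= 2^-1]) `|`
  ((I `*` I) `&` [set z : R * R | 2^-1 <= z.1]).
Proof.
rewrite -setIUr; apply/esym/setIidl => z _ /=.
by case: (lerP z.1 2^-1) => [|/ltW]; [left|right].
Qed.

Lemma square_split2 : I `*` I =
  ((I `*` I) `&` [set z : R * R | z.2 <= 2^-1]) `|`
  ((I `*` I) `&` [set z : R * R | 2^-1 <= z.2]).
Proof.
rewrite -setIUr; apply/esym/setIidl => z _ /=.
by case: (lerP z.2 2^-1) => [|/ltW]; [left|right].
Qed.

Lemma unit_split : I =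
  (I `&` [set t : R | t <= 2^-1]) `|` (I `&` [set t : R | 2^-1 <= t]).
Proof.
rewrite -setIUr; apply/esym/setIidl => z _ /=.
by case: (lerP z 2^-1) => [|/ltW]; [left|right].
Qed.

Lemma closed_square : closed (I `*` I).
Proof.
have -> : I `*` I = (fst @^-1` I) `&` (snd @^-1` I) :> set (R * R) by [].
apply: closedI.
- apply: (continuous_closedP _).1; first exact: continuous_fst.
  exact: interval_closed.
- apply: (continuous_closedP _).1; first exact: continuous_snd.
  exact: interval_closed.
Qed.

Lemma closed_le_half (T : topologicalType) (f : T -> R) : continuous f ->
  closed [set z | f z <= 2^-1] /\ closed [set z | 2^-1 <= f z].
Proof.
move=> cf; split.
- exact: ((continuous_closedP f).1 cf _ (@closed_le _ _)).
- exact: ((continuous_closedP f).1 cf _ (@closed_ge _ _)).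
Qed.

Lemma homotopic_refl (x : X) (c : loop x) : homotopic x c c.
Proof.
have [cc c0 c1] := asboolW (loopP c).
exists (c \o snd); split=> //=.
apply: (within_comp (B := I)) cc; last by move=> z [].
exact/continuous_subspaceT/continuous_snd.
Qed.

Lemma homotopic_sym (x : X) (c d : R -> X) : homotopic x c d -> homotopic x d c.
Proof.
move=> [F [cF F0 F1 Fx]].
exists (F \o (fun z => (-1 * z.1 + 1, z.2))); split=> /=.
- apply: (within_comp (B := I `*` I)) cF.
    apply/continuous_subspaceT/continuous_pair; last exact: continuous_snd.
    exact/continuous_affine/continuous_fst.
  move=> [s t] [/= /unitP[s0 s1] It]; split=> //=; apply/unitP; split; lra.
- by move=> t It; rewrite mulr0 add0r F1.
- by move=> t It; rewrite mulr1 addNr F0.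
- by move=> s /unitP[s0 s1]; apply: Fx; apply/unitP; split; lra.
Qed.

Lemma homotopic_trans (x : X) (c d e : R -> X) :
  homotopic x c d -> homotopic x d e -> homotopic x c e.
Proof.
move=> [F [cF F0 F1 Fx]] [E [cE E0 E1 Ex]].
pose f (z : R * R) := F (2 * z.1 + 0, z.2).
pose g (z : R * R) := E (2 * z.1 + -1, z.2).
exists (fun z => if z.1 <= 2^-1 then f z else g z); split=> /=.
- rewrite square_split1; apply: withinU_continuous.
  + by apply: closedI closed_square (closed_le_half (@continuous_fst _ _)).1.
  + by apply: closedI closed_square (closed_le_half (@continuous_fst _ _)).2.
  + apply: (@within_eq _ _ _ f); first by move=> z [_ /= ->].
    apply: (within_comp (B := I `*` I)) cF.
      apply/continuous_subspaceT/continuous_pair; last exact: continuous_snd.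
      exact/continuous_affine/continuous_fst.
    move=> [s t] [[/= /unitP[s0 s1] It] sh]; split=> //=.
    by apply/unitP; split; lra.
  + apply: (@within_eq _ _ _ g).
      move=> [s t] [[/= Is It] hs]; case: ifP => // sh.
      have -> : s = 2^-1 by lra.
      rewrite /f /g /= mulfV ?pnatr_eq0// addr0 subrr.
      by rewrite F1 // E0.
    apply: (within_comp (B := I `*` I)) cE.
      apply/continuous_subspaceT/continuous_pair; last exact: continuous_snd.
      exact/continuous_affine/continuous_fst.
    move=> [s t] [[/= /unitP[s0 s1] It] sh]; split=> //=.
    by apply/unitP; split; lra.
- by move=> t It; rewrite ifT ?invr_ge0// /f /= mulr0 addr0 F0.
- move=> t It; rewrite ifF; last by lra.
  by rewrite /g /= (_ : 2 * 1 + -1 = 1 :> R) ?E1 //; lra.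
- move=> s /unitP[s0 s1]; case: ifP => sh; rewrite /f /g /=.
    by apply: Fx; apply/unitP; split; lra.
  by apply: Ex; apply/unitP; split; lra.
Qed.

Definition concat (c d : R -> X) : R -> X :=
  fun t => if t <= 2^-1 then c (2 * t) else d (2 * t - 1).

Lemma concat_loop_subproof (x : X) (c d : loop x) :
  `[< is_loop x (concat c d) >].
Proof.
have [cc c0 c1] := asboolW (loopP c); have [cd d0 d1] := asboolW (loopP d).
have ci : continuous (id : R -> R) by move=> z; exact: cvg_id.
apply/asboolP; split.
- rewrite unit_split; apply: withinU_continuous.
  + by apply: closedI (@interval_closed _ _ _ _ _) (closed_le_half ci).1.
  + by apply: closedI (@interval_closed _ _ _ _ _) (closed_le_half ci).2.
  + apply: (@within_eq _ _ _ (c \o (fun t => 2 * t + 0))).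
      by move=> z [_ /= zh]; rewrite /concat zh addr0.
    apply: (within_comp (B := I)) cc.
      exact/continuous_subspaceT/continuous_affine.
    by move=> t [/= /unitP[t0 t1] th]; apply/unitP; split; lra.
  + apply: (@within_eq _ _ _ (d \o (fun t => 2 * t + -1))).
      move=> t [/= It ht]; rewrite /concat; case: ifP => // th.
      have -> : t = 2^-1 by lra.
      by rewrite mulfV ?pnatr_eq0// subrr c1 d0.
    apply: (within_comp (B := I)) cd.
      exact/continuous_subspaceT/continuous_affine.
    by move=> t [/= /unitP[t0 t1] th]; apply/unitP; split; lra.
- by rewrite /concat ifT ?invr_ge0// mulr0.
- by rewrite /concat ifF; [rewrite (_ : 2 * 1 - 1 = 1 :> R) //|]; lra.
Qed.

Definition concat_loop (x : X) (c d : loop x) : loop x :=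
  Loop (concat_loop_subproof c d).

Lemma rev_loop_subproof (x : X) (c : loop x) :
  `[< is_loop x (fun t => c (1 - t)) >].
Proof.
have [cc c0 c1] := asboolW (loopP c).
apply/asboolP; split; [|by rewrite subr0|by rewrite subrr].
apply: (@within_eq _ _ _ (c \o (fun t => -1 * t + 1))).
  by move=> t _ /=; congr (loop_fun c); lra.
apply: (within_comp (B := I)) cc.
  by apply/continuous_subspaceT/continuous_affine => z; exact: cvg_id.
by move=> t /unitP[t0 t1]; apply/unitP; split; lra.
Qed.

Definition rev_loop (x : X) (c : loop x) : loop x := Loop (rev_loop_subproof c).

Lemma cst_loop_subproof (x : X) : `[< is_loop x (fun=> x) >].
Proof.
by apply/asboolP; split=> //; apply/continuous_subspaceT => z; exact: cvg_cst.
Qed.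

Definition cst_loop (x : X) : loop x := Loop (cst_loop_subproof x).

Lemma homotopic_concat (x : X) (c c' d d' : loop x) :
  homotopic x c c' -> homotopic x d d' ->
  homotopic x (concat_loop c d) (concat_loop c' d').
Proof.
move=> [F [cF F0 F1 Fx]] [E [cE E0 E1 Ex]].
pose f (z : R * R) := F (z.1, 2 * z.2 + 0).
pose g (z : R * R) := E (z.1, 2 * z.2 + -1).
exists (fun z => if z.2 <= 2^-1 then f z else g z); split=> /=.
- rewrite square_split2; apply: withinU_continuous.
  + by apply: closedI closed_square (closed_le_half (@continuous_snd _ _)).1.
  + by apply: closedI closed_square (closed_le_half (@continuous_snd _ _)).2.
  + apply: (@within_eq _ _ _ f); first by move=> z [_ /= ->].
    apply: (within_comp (B := I `*` I)) cF.
      apply/continuous_subspaceT/continuous_pair; first exact: continuous_fst.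
      exact/continuous_affine/continuous_snd.
    move=> [s t] [[/= Is /unitP[t0 t1]] th]; split=> //=.
    by apply/unitP; split; lra.
  + apply: (@within_eq _ _ _ g).
      move=> [s t] [[/= Is It] ht]; case: ifP => // th.
      have -> : t = 2^-1 by lra.
      rewrite /f /g /= mulfV ?pnatr_eq0// addr0 subrr.
      by rewrite (Fx _ Is).2 (Ex _ Is).1.
    apply: (within_comp (B := I `*` I)) cE.
      apply/continuous_subspaceT/continuous_pair; first exact: continuous_fst.
      exact/continuous_affine/continuous_snd.
    move=> [s t] [[/= Is /unitP[t0 t1]] th]; split=> //=.
    by apply/unitP; split; lra.
- move=> t /unitP[t0 t1]; rewrite /f /g /concat; case: ifP => th /=.
    by rewrite addr0 F0 //; apply/unitP; split; lra.
  by rewrite E0 //; apply/unitP; split; lra.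
- move=> t /unitP[t0 t1]; rewrite /f /g /concat; case: ifP => th /=.
    by rewrite addr0 F1 //; apply/unitP; split; lra.
  by rewrite E1 //; apply/unitP; split; lra.
- move=> s Is; rewrite ifT ?invr_ge0// ifF; last by lra.
  rewrite /f /g /= mulr0 addr0 (_ : 2 * 1 + -1 = 1 :> R); last by lra.
  by rewrite (Fx _ Is).1 (Ex _ Is).2.
Qed.

Lemma homotopic_reparam (x : X) (c e e' : loop x) (phi psi : R -> R) :
  continuous phi -> continuous psi ->
  (forall t, I t -> I (phi t)) -> (forall t, I t -> I (psi t)) ->
  phi 0 = psi 0 -> phi 1 = psi 1 ->
  (forall t, I t -> e t = c (phi t)) -> (forall t, I t -> e' t = c (psi t)) ->
  homotopic x e e'.
Proof.
move=> cphi cpsi Iphi Ipsi e0 e1 eE e'E.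
have [cc c0 c1] := asboolW (loopP c).
have [_ E0 E1] := asboolW (loopP e); have [_ E0' E1'] := asboolW (loopP e').
have I0 : I 0 by apply/unitP; split; lra.
have I1 : I 1 by apply/unitP; split; lra.
exists (c \o (fun z => (1 - z.1) * phi z.2 + z.1 * psi z.2)); split.
- apply: (within_comp (B := I)) cc.
    apply/continuous_subspaceT => z; apply: cvgD; apply: cvgM.
    + by apply: cvgB; [exact: cvg_cst|exact: continuous_fst].
    + by apply: (continuous_comp _ (cphi _)); exact: continuous_snd.
    + exact: continuous_fst.
    + by apply: (continuous_comp _ (cpsi _)); exact: continuous_snd.
  move=> [s t] [/= /unitP[s0 s1] It].
  have /unitP[p0 p1] := Iphi _ It; have /unitP[q0 q1] := Ipsi _ It.
  by apply/unitP; split; nra.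
- by move=> t It /=; rewrite subr0 mul1r mul0r addr0 eE.
- by move=> t It /=; rewrite subrr mul1r mul0r add0r e'E.
- move=> s Is /=; rewrite -e0 -e1 -!mulrDl subrK !mul1r -!eE //.
Qed.

Definition homotopicb (x : X) : rel (loop x) :=
  fun c d => `[< homotopic x c d >].

Lemma homotopicb_refl (x : X) : reflexive (@homotopicb x).
Proof. by move=> c; apply/asboolP/homotopic_refl. Qed.

Lemma homotopicb_sym (x : X) : symmetric (@homotopicb x).
Proof.
move=> c d; apply/idP/idP => /asboolP cd; apply/asboolP; exact: homotopic_sym.
Qed.

Lemma homotopicb_trans (x : X) : transitive (@homotopicb x).
Proof.
by move=> c d e /asboolP dc /asboolP ce; apply/asboolP/(homotopic_trans dc).
Qed.

Canonical homotopic_equiv (x : X) := EquivRel (@homotopicb x)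
  (@homotopicb_refl x) (@homotopicb_sym x) (@homotopicb_trans x).

Definition pi1 (x : X) : Type := {eq_quot @homotopicb x}.

HB.instance Definition _ (x : X) := Choice.on (pi1 x).

Definition pi1_class (x : X) (c : loop x) : pi1 x :=
  \pi_({eq_quot @homotopicb x}) c.

Definition pi1_repr (x : X) (a : pi1 x) : loop x :=
  repr (a : {eq_quot @homotopicb x}).

Lemma pi1_reprK (x : X) : cancel (@pi1_repr x) (@pi1_class x).
Proof. exact: reprK. Qed.

Lemma pi1_classP (x : X) (c d : loop x) :
  pi1_class c = pi1_class d <-> homotopic x c d.
Proof.
split => [/eqquotP|] ; first by move/asboolP.
by move=> cd; apply/eqquotP/asboolP.
Qed.

Definition pi1_mul (x : X) (a b : pi1 x) : pi1 x :=
  pi1_class (concat_loop (pi1_repr a) (pi1_repr b)).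
Definition pi1_one (x : X) : pi1 x := pi1_class (cst_loop x).
Definition pi1_inv (x : X) (a : pi1 x) : pi1 x :=
  pi1_class (rev_loop (pi1_repr a)).

Lemma pi1_mulE (x : X) (c d : loop x) :
  pi1_mul (pi1_class c) (pi1_class d) = pi1_class (concat_loop c d).
Proof. by apply/pi1_classP/homotopic_concat; apply/pi1_classP; exact: pi1_reprK. Qed.

Lemma continuous_id : continuous (id : R -> R).
Proof. by move=> z; exact: cvg_id. Qed.

Lemma continuous_minmax (f g : R -> R) : continuous f -> continuous g ->
  continuous (fun t => Num.min (f t) (g t)) /\
  continuous (fun t => Num.max (f t) (g t)).
Proof.
by move=> cf cg; split=> z; [apply: continuous_min|apply: continuous_max];
  [exact: cf|exact: cg|exact: cf|exact: cg].
Qed.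

Lemma pi1_mulA (x : X) : associative (@pi1_mul x).
Proof.
move=> a b c; rewrite -(pi1_reprK a) -(pi1_reprK b) -(pi1_reprK c) !pi1_mulE.
move: (pi1_repr a) (pi1_repr b) (pi1_repr c) => {}a {}b {}c.
apply/pi1_classP.
pose phi (t : R) := Num.min (Num.min (2 * t + 0) (1 * t + 4^-1)) (2^-1 * t + 2^-1).
apply: (@homotopic_reparam x (concat_loop a (concat_loop b c)) _ _ id phi).
- exact: continuous_id.
- apply: (continuous_minmax (continuous_minmax _ _).1 _).1;
  exact/continuous_affine/continuous_id.
- by [].
- move=> t /unitP[t0 t1]; apply/unitP; rewrite /phi !le_min !ge_min.
  by split; [apply/andP; split; [apply/andP; split|]|apply/orP; right]; lra.
- by rewrite /phi !minElt; do !case: ifP; lra.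
- by rewrite /phi !minElt; do !case: ifP; lra.
- by [].
- move=> t /unitP[t0 t1]; rewrite /= /concat /phi /= /concat !minElt.
  by do !case: ifP; move=> *; first [exfalso; lra | congr (loop_fun _ _); lra].
Qed.

Lemma pi1_mul1 (x : X) : left_id (pi1_one x) (@pi1_mul x).
Proof.
move=> a; rewrite -(pi1_reprK a) pi1_mulE; move: (pi1_repr a) => {}a.
have [_ a0 a1] := asboolW (loopP a).
apply/pi1_classP.
apply: (@homotopic_reparam x a _ _ (fun t => Num.max 0 (2 * t + -1)) id) => //.
- apply: (continuous_minmax _ _).2; first by move=> z; exact: cvg_cst.
  exact/continuous_affine/continuous_id.
- exact: continuous_id.
- move=> t /unitP[t0 t1]; apply/unitP; rewrite le_max ge_max; clear a0 a1.
  by split; [rewrite lexx|apply/andP; split; lra].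
- by rewrite maxElt; clear; case: ifP; lra.
- by rewrite maxElt; clear; case: ifP; lra.
- move=> t /unitP[t0 t1]; rewrite /= /concat maxElt.
  by do !case: ifP; move=> *; first [exfalso; clear a0 a1; lra | done | rewrite -a0; congr (loop_fun _ _); clear a0 a1; lra].
Qed.

Lemma pi1_mulr1 (x : X) : right_id (pi1_one x) (@pi1_mul x).
Proof.
move=> a; rewrite -(pi1_reprK a) pi1_mulE; move: (pi1_repr a) => {}a.
have [_ a0 a1] := asboolW (loopP a).
apply/pi1_classP.
apply: (@homotopic_reparam x a _ _ (fun t => Num.min 1 (2 * t + 0)) id) => //.
- apply: (continuous_minmax _ _).1; first by move=> z; exact: cvg_cst.
  exact/continuous_affine/continuous_id.
- exact: continuous_id.
- move=> t /unitP[t0 t1]; apply/unitP; rewrite le_min ge_min lexx.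
  by clear a0 a1; split=> //; apply/andP; split; lra.
- by rewrite minElt; clear; case: ifP; lra.
- by rewrite minElt; clear; case: ifP; lra.
- move=> t /unitP[t0 t1]; rewrite /= /concat minElt.
  by do !case: ifP; move=> *;
    first [exfalso; clear a0 a1; lra | congr (loop_fun _ _); clear a0 a1; lra | rewrite a1 | rewrite -a1; congr (loop_fun _ _); clear a0 a1; lra].
Qed.

Lemma pi1_mulV (x : X) : left_inverse (pi1_one x) (@pi1_inv x) (@pi1_mul x).
Proof.
move=> a; rewrite -{2}(pi1_reprK a) pi1_mulE; move: (pi1_repr a) => {}a.
have [_ a0 a1] := asboolW (loopP a).
apply/pi1_classP.
apply: (@homotopic_reparam x a _ _
  (fun t => Num.max (- 2 * t + 1) (2 * t + -1)) (fun=> 1)) => //.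
- by apply: (continuous_minmax _ _).2; exact/continuous_affine/continuous_id.
- by move=> z; exact: cvg_cst.
- move=> t /unitP[t0 t1]; apply/unitP; rewrite le_max ge_max; clear a0 a1.
  split; last by apply/andP; split; lra.
  by case: (lerP t 2^-1) => ?; apply/orP; [left|right]; lra.
- by move=> t _; apply/unitP; clear a0 a1; split; lra.
- by rewrite maxElt; clear; case: ifP; lra.
- by rewrite maxElt; clear; case: ifP; lra.
- move=> t /unitP[t0 t1]; rewrite /= /concat maxElt.
  by do !case: ifP; move=> *; first [exfalso; clear a0 a1; lra | congr (loop_fun _ _); clear a0 a1; lra].
Qed.

Lemma pi1_mulrV (x : X) : right_inverse (pi1_one x) (@pi1_inv x) (@pi1_mul x).
Proof.
move=> a; rewrite -{1}(pi1_reprK a) pi1_mulE; move: (pi1_repr a) => {}a.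
have [_ a0 a1] := asboolW (loopP a).
apply/pi1_classP.
apply: (@homotopic_reparam x a _ _
  (fun t => Num.min (2 * t + 0) (- 2 * t + 2)) (fun=> 0)) => //.
- by apply: (continuous_minmax _ _).1; exact/continuous_affine/continuous_id.
- by move=> z; exact: cvg_cst.
- move=> t /unitP[t0 t1]; apply/unitP; rewrite le_min ge_min.
  clear a0 a1; split; first by apply/andP; split; lra.
  by case: (lerP t 2^-1) => ?; apply/orP; [left|right]; lra.
- by move=> t _; apply/unitP; clear a0 a1; split; lra.
- by rewrite minElt; clear; case: ifP; lra.
- by rewrite minElt; clear; case: ifP; lra.
- move=> t /unitP[t0 t1]; rewrite /= /concat minElt.
  by do !case: ifP; move=> *; first [exfalso; clear a0 a1; lra | congr (loop_fun _ _); clear a0 a1; lra].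
Qed.

HB.instance Definition _ (x : X) := isGroup.Build (pi1 x)
  (@pi1_mulA x) (@pi1_mul1 x) (@pi1_mulr1 x) (@pi1_mulV x) (@pi1_mulrV x).

End FundamentalGroup.

Lemma interval_adj_sym n :
  symmetric (fun i j : 'I_n.+1 => (i <= j.+1)%N && (j <= i.+1)%N).
Proof. by move=> i j; rewrite andbC. Qed.

Definition interval_graph (n : nat) : graph := Graph (@interval_adj_sym n).

Lemma prod_adj_sym (G H : graph) :
  symmetric (fun x y : G * H => adj x.1 y.1 && adj x.2 y.2).
Proof. by move=> x y; rewrite !(adj_sym _ y.1, adj_sym _ y.2) adj_sym. Qed.

Definition prod_graph (G H : graph) : graph := Graph (@prod_adj_sym G H).

Record xhomotopy (G H : graph) (f : ghom G H) (n : nat) := XHomotopy {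
  xhom :> ghom (prod_graph G (interval_graph n)) H;
  xhom_start : forall x, xhom (x, ord0) = f x;
  xhom_end : forall x, xhom (x, ord_max) = f x }.

Definition hom_pi1 (R : realType) (G H : graph) (f : ghom G H) : groupType :=
  pi1 R (component_point (order_complex_point R (multihom_of f))).

Definition equiv_hom_pi1 (R : realType) (G H : graph) (f : ghom G H) (v : G)
    (pG : ucover2 v) (pH : ucover2 (f v)) (ft : based_lift f pG pH) :
    groupType :=
  pi1 R (component_point (order_complex_point R (equiv_multihom_of ft))).

Section Realizable.
Variables (G H : graph) (f : ghom G H) (v : G).

(* h(v',0), h(v,1), h(v',1), ..., h(v',n-1), h(v,n); the initial vertex
   h(v,0) = f v is left implicit as for every walk *)
Definition trace n (h : xhomotopy f n) (v' : G) : seq H :=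
  flatten [seq [:: h (v', inord i); h (v, inord i.+1)] | i <- iota 0 n].

Lemma trace_walk_subproof n (h : xhomotopy f n) (v' : G) : adj v v' ->
  path (@adj H) (f v) (trace h v') && (last (f v) (trace h v') == f v).
Proof.
move=> vv'; rewrite /trace.
have start : f v = h (v, inord 0).
  by rewrite -(xhom_start h); congr (h (_, _)); apply: val_inj; rewrite /= inordK.
have fin : f v = h (v, inord n).
  by rewrite -(xhom_end h); congr (h (_, _)); apply: val_inj; rewrite /= inordK.
rewrite [X in _ == X]fin [f v]start.
suff: forall k m, (m + k = n)%N ->
    path (@adj H) (h (v, inord m))
      (flatten [seq [:: h (v', inord i); h (v, inord i.+1)] | i <- iota m k]) &&
    (last (h (v, inord m))
      (flatten [seq [:: h (v', inord i); h (v, inord i.+1)] | i <- iota m k])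
      == h (v, inord n)).
  exact.
elim=> [|k IHk] m mkn; first by rewrite addn0 in mkn; rewrite mkn /= eqxx.
have mn : (m < n)%N by rewrite -mkn -addSnnS leq_addr.
have /andP[p l] := IHk m.+1 (etrans (addSnnS m k) mkn).
rewrite /= p l !andbT; apply/andP; split; apply: ghom_adj => /=.
  by rewrite vv' leqnSn.
by rewrite adj_sym vv' !inordK ?ltnS// ?(ltnW mn)// leqnn ltnW.
Qed.

Definition trace_walk n (h : xhomotopy f n) (v' : G) (vv' : adj v v') :
  walk (f v) (f v) := Walk (trace_walk_subproof h vv').

Definition realizable : set (pi12 (f v)) :=
  [set g | exists n (h : xhomotopy f n) (v' : G) (vv' : adj v v'),
     pi12_class (trace_walk h vv') = g].

End Realizable.

Arguments realizable {G H} f v _.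

(* 1 -> A -> B -> K -> 1, where the subgroup K of C is given as a set: the map
   B -> K is the corestriction of j. *)
Definition short_exact (A B C : groupType) (K : set C)
    (i : {multiplicative A -> B}) (j : {multiplicative B -> C}) : Prop :=
  [/\ injective i, range i = j @^-1` [set 1%g] & range j = K].

(* Main.v *)
(* The map q sending an equivariant multi-homomorphism eta to
   x |-> p_H(eta(x~)), for any x~ over x, is a covering of posets: because p_H
     is
   injective on second neighborhoods, an element above or below q(eta) has
   exactly one lift above or below eta.  The map |q| induced
     by q on realizations of
   order complexes is then a covering map, the open star of a vertex being
   evenly covered by the open stars of its lifts.  Covering theory makes pi_1
   injective under |q|, with image the loops whose lift from f~ is closed.

   The lift of a loop at f from f~ ends at a lift f' of f, and f' = g.f~ for
     the unique
   g in pi_1^2(H, w) with f'(v~) = {g.w~}; j sends the loop to g.  As f' is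
   equivariant, g commutes with f_*(Gamma), hence acts on Hom^Gamma(G~, H~)
   over Hom(G, H), which makes j multiplicative.

   For the image of j, the ends of a path in |Hom^Gamma(G~, H~)| are joined by a
   zigzag of comparable elements; choosing a homomorphism under each projected
   element gives a x-homotopy, and conversely a x-homotopy lifts to a
   zigzag.  The trace of the x-homotopy lifts to a walk in H~ from w~ to
   f'(v~), hence its class is g. *)
Require Import Defs.
From HB Require Import structures.
From mathcomp Require Import all_boot all_order all_algebra finmap.
From mathcomp Require Import generic_quotient all_classical reals.
From mathcomp Require Import topology normedtype.
From mathcomp Require Import lra.
From Stdlib Require Import Relation_Operators Operators_Properties.
Set Implicit Arguments.
Unset Strict Implicit.
Unset Printing Implicit Defensive.

Import Order.TTheory GRing.Theory Num.Theory.
Import numFieldTopology.Exports numFieldNormedType.Exports.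

Local Open Scope classical_set_scope.

(** * Covering maps *)

(** [P] and its negation are both open relative to [A], so [P] cuts out a nonempty clopen part of a
    connected set. *)
Lemma connected_ind (T : topologicalType) (A : set T) (P : T -> Prop) :
  connected A ->
  (forall z, A z -> P z -> \forall x \near within A (nbhs z), P x) ->
  (forall z, A z -> ~ P z -> \forall x \near within A (nbhs z), ~ P x) ->
  forall z0, A z0 -> P z0 -> forall z, A z -> P z.
Proof.
move=> cA oP oN z0 Az0 Pz0 z Az.
suff /seteqP[_] : A `&` P = A by move=> /(_ z Az)[].
have h (Q : T -> Prop) : (forall z, A z -> Q z ->
    \forall x \near within A (nbhs z), Q x) ->
    A `&` Q = A `&` (fun x => A x -> Q x)°.
  move=> oQ; apply/seteqP; split=> x [Ax Qx]; split=> //; first exact: oQ.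
  exact: (interior_subset Qx).
apply: cA; first by exists z0.
- by exists (fun x => A x -> P x)°; [exact: open_interior|exact: h].
- exists (~` (fun x => A x -> ~ P x)°).
    exact/open_closedC/open_interior.
  apply/seteqP; split=> x [Ax Px]; split=> //.
    by move=> /interior_subset/(_ Ax).
  apply: contrapT => NPx; apply: Px.
  by have /seteqP[/(_ x (conj Ax NPx))[]] := h (fun x => ~ P x) oN.
Qed.

Section Covering.
Variables (E B : topologicalType) (p : E -> B).

(* [s e] is the section over [U] through the sheet containing [e]. *)
Definition evenly_covered (U : set B) (s : E -> B -> E) : Prop :=
  [/\ forall e, U (p e) -> s e (p e) = e,
      forall e u, U (p e) -> U u -> p (s e u) = u,
      forall e, U (p e) -> {within U, continuous (s e)},
      forall e, U (p e) -> \forall e' \near e, s e (p e') = e' &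
      forall e e' u, p e = p e' -> U (p e) -> U u -> s e u = s e' u -> e = e'].

(** Fibres may be empty: [p] is not asked to be surjective. *)
Definition covering_map : Prop :=
  continuous p /\
  forall b, exists2 U, open_nbhs b U & exists s, evenly_covered U s.

Hypothesis pcov : covering_map.

(** The locus of agreement is clopen in [A]: near [z] the lifts follow the sheets through [g z] and
    [g' z], which coincide if these points are equal and are disjoint otherwise. *)
Lemma lift_unique (T : topologicalType) (A : set T) (g g' : T -> E) :
  connected A -> {within A, continuous g} -> {within A, continuous g'} ->
  (forall z, A z -> p (g z) = p (g' z)) ->
  forall z0, A z0 -> g z0 = g' z0 -> forall z, A z -> g z = g' z.
Proof.
move=> cA /subspace_continuousP cg /subspace_continuousP cg' pg.
have [cp cov] := pcov.
apply: (connected_ind cA) => z Az gz;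
  have [U [oU Uz] [s [s1 s2 _ s4 s5]]] := cov (p (g z)).
- have n1 : \forall x \near within A (nbhs z), s (g z) (p (g x)) = g x := cg _
  Az _ (s4 _ Uz).
  have Uz' : U (p (g' z)) by rewrite -gz.
  have n2 : \forall x \near within A (nbhs z), s (g' z) (p (g' x)) = g' x :=
    cg' _ Az _ (s4 _ Uz').
  have : \forall x \near within A (nbhs z), A x by exact: withinT.
  move: n1 n2; apply: filterS3 => x /= <- <- Ax.
  by rewrite pg// gz.
- have n1 : \forall x \near within A (nbhs z), s (g z) (p (g x)) = g x := cg _
  Az _ (s4 _ Uz).
  have Uz' : U (p (g' z)) by rewrite -pg.
  have n2 : \forall x \near within A (nbhs z), s (g' z) (p (g' x)) = g' x :=
    cg' _ Az _ (s4 _ Uz').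
  have : \forall x \near within A (nbhs z), A x /\ U (p (g x)).
    apply: filterI; first exact: withinT.
    have := cp (g z) U; rewrite /= => h.
    exact: (cg _ Az _ (h (open_nbhs_nbhs (conj oU Uz)))).
  move: n1 n2; apply: filterS3 => x /= e1 e2 [Ax Ux] e; apply: gz.
  by apply: (s5 _ _ (p (g x))) => //; [exact: pg|rewrite e1 pg// e2].
Qed.

End Covering.

(** * Lifting of squares through a covering map *)

Section Squares.
Local Open Scope ring_scope.
Variable R : realType.

Local Notation I := (`[0, 1]%classic : set R).

(** A supremum argument that stands in for a subdivision of the interval by compactness: [Q] holds
    on short intervals and is additive. *)
Lemma interval_ind (Q : R -> R -> Prop) :
  (forall x, I x -> exists2 d, 0 < d & forall a b, 0 <= a -> a <= b -> b <= 1 ->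
     `|a - x| < d -> `|b - x| < d -> Q a b) ->
  (forall a m b, 0 <= a -> a <= m -> m <= b -> b <= 1 ->
     Q a m -> Q m b -> Q a b) ->
  Q 0 1.
Proof.
move=> loc add; pose S := [set x | I x /\ Q 0 x].
have I0 : I 0 by apply/unitP; rewrite lexx ler01.
have S0 : S 0.
  by split=> //; have [d d0 h] := loc 0 I0; apply: h; rewrite ?subrr ?normr0.
have ubS : ubound S 1 by move=> x [/unitP[_]].
have hS : has_sup S by split; [exists 0|exists 1].
pose x := sup S.
have Ix : I x.
  apply/unitP; split; first by apply: ub_le_sup => //; exists 1.
  by apply: ge_sup => //; exists 0.
have [d d0 hd] := loc x Ix.
have [y Sy] := sup_adherent d0 hS; rewrite -/x => xy.
have yx : y <= x by apply: ub_le_sup => //; exists 1.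
case: Sy => /unitP[y0 y1] Qy; case/unitP: Ix => x0 x1.
(* [b] overshoots the supremum [x] unless [x] is 1; as [Q 0 b] holds, [b <= x], which forces
   [b = 1]. *)
pose b := Num.min 1 (x + d / 2).
have db : d / 2 * 2 = d by rewrite divfK ?pnatr_eq0.
have xb : x <= b by rewrite le_min x1 /=; lra.
have Qb : Q 0 b.
  apply: (add _ y) => //; rewrite ?ge_min ?lexx//; first by lra.
  apply: hd => //; rewrite ?ge_min ?lexx//; first by lra.
    by rewrite distrC ger0_norm; lra.
  rewrite ger0_norm ?subr_ge0// ltrBlDl gt_min; apply/orP; right; lra.
have bx : b <= x.
  apply: ub_le_sup; first by exists 1.
  by split=> //; apply/unitP; rewrite ge_min lexx; split => //; lra.
suff : b = 1 by move=> <-.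
move: xb bx; rewrite /b minElt; case: ifP => //; lra.
Qed.

Definition rect (a b c d : R) : set (R * R) :=
  [set z | (a <= z.1 <= b) && (c <= z.2 <= d)].

Lemma rect01 : rect 0 1 0 1 = I `*` I.
Proof.
by apply/seteqP; split=> -[s t]; rewrite /rect/= !in_itv/= => /andP.
Qed.

Lemma closed_rect a b c d : closed (rect a b c d).
Proof.
have -> : rect a b c d = (fst @^-1` `[a, b]) `&` (snd @^-1` `[c, d]).
  by apply/seteqP; split=> -[s t]; rewrite /rect/= !in_itv/= => /andP.
have h (f : R * R -> R) u v : continuous f -> closed (f @^-1` `[u, v]).
  by move=> cf; apply: (continuous_closedP _).1 cf _ _; exact: interval_closed.
by apply: closedI; apply: h => z; [exact: cvg_fst|exact: cvg_snd].
Qed.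

Lemma connected_vline a c d : connected ((fun t => (a, t)) @` `[c, d] : set (R
  * R)).
Proof.
apply: connected_continuous_connected; first exact: segment_connected.
by apply/continuous_subspaceT/continuous_pair => t;
  [exact: cvg_cst|exact: cvg_id].
Qed.

Lemma connected_hline a c d : connected ((fun t => (t, a)) @` `[c, d] : set (R
  * R)).
Proof.
apply: connected_continuous_connected; first exact: segment_connected.
by apply/continuous_subspaceT/continuous_pair => t;
  [exact: cvg_id|exact: cvg_cst].
Qed.

Variables (E B : topologicalType) (p : E -> B).
Hypothesis pcov : covering_map p.
Variable F : R * R -> B.
Hypothesis cF : {within I `*` I, continuous F}.

(** The value at the corner [(a, c)] is arbitrary in its fibre, so that adjacent rectangles can be
    lifted one after the other. *)
Let Q a b c d := forall e, p e = F (a, c) ->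
  exists F', [/\ {within rect a b c d, continuous F'},
    forall z, rect a b c d z -> p (F' z) = F z & F' (a, c) = e].

Let glue (A A' : set (R * R)) (test : pred (R * R)) (F1 F2 : R * R -> E) :
  closed A -> closed A' -> (forall z, A z -> test z) ->
  (forall z, A' z -> test z -> F1 z = F2 z) ->
  {within A, continuous F1} -> {within A', continuous F2} ->
  {within A `|` A', continuous (fun z => if test z then F1 z else F2 z)}.
Proof.
move=> cA cA' t1 t2 c1 c2; apply: withinU_continuous => //.
  by apply: within_eq c1 => z /t1 ->.
by apply: within_eq c2 => z A'z; case: ifP => // /t2 ->.
Qed.

Lemma rect_split1 a m b c d : a <= m -> m <= b ->
  rect a b c d = rect a m c d `|` rect m b c d.
Proof.
move=> am mb; apply/seteqP; split=> -[s t] /=; rewrite /rect/=.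
  move=> /andP[/andP[as_ sb] ->]; case: (lerP s m) => sm; [left|right].
    by rewrite as_ /=.
  by rewrite sb (ltW sm).
by move=> [|] /andP[/andP[? ?] ->]; rewrite andbT; apply/andP; split; lra.
Qed.

Lemma rect_split2 a b c m d : c <= m -> m <= d ->
  rect a b c d = rect a b c m `|` rect a b m d.
Proof.
move=> am mb; apply/seteqP; split=> -[s t] /=; rewrite /rect/=.
  move=> /andP[-> /andP[as_ sb]]; case: (lerP t m) => sm; [left|right].
    by rewrite as_ /=.
  by rewrite sb (ltW sm).
by move=> [|] /andP[-> /andP[? ?]] /=; apply/andP; split; lra.
Qed.

(** The lift over the right rectangle starts at the value of the left lift at [(m, c)]. The two
    agree on the common side, which is connected, by uniqueness of lifts, and so they glue. *)
Let add1 a m b c d : a <= m -> m <= b -> c <= d ->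
  Q a m c d -> Q m b c d -> Q a b c d.
Proof.
move=> am mb cd Q1 Q2 e pe; have [F1 [c1 l1 e1]] := Q1 e pe.
have mc : rect a m c d (m, c) by rewrite /rect /= am !lexx cd.
have [F2 [c2 l2 e2]] := Q2 (F1 (m, c)) (l1 _ mc).
have agree t : c <= t <= d -> F1 (m, t) = F2 (m, t).
  move=> ct.
  apply: (lift_unique pcov (@connected_vline m c d) (g := F1) (g' := F2) _ _ _
    (z0 := (m, c))) => //.
  - by apply: continuous_subspaceW c1 => z [t' /= ht <-];
    rewrite /rect/= am lexx; move: ht; rewrite in_itv.
  - by apply: continuous_subspaceW c2 => z [t' /= ht <-];
    rewrite /rect/= mb lexx; move: ht; rewrite in_itv.
  - move=> z [t' /=]; rewrite in_itv /= => h <-; rewrite l1 ?l2//.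
      by rewrite /rect /= h lexx mb.
    by rewrite /rect /= h lexx am.
  - by exists c; rewrite //= in_itv /= lexx cd.
  - by exists t; rewrite //= in_itv.
exists (fun z => if z.1 <= m then F1 z else F2 z); split.
- rewrite (rect_split1 _ _ am mb);
  apply: (glue (test := fun z => z.1 <= m)) => //; try exact: closed_rect.
    by move=> z /andP[/andP[]].
  move=> [s t] /andP[/= /andP[ms _] ct] /= sm.
  have -> : s = m by lra.
  exact: agree.
- move=> z; rewrite (rect_split1 _ _ am mb) => -[] rz.
    by case/andP: (rz) => /andP[_ ->] _; exact: l1.
  case: ifP => zm; last exact: l2.
  apply: l1; move: rz zm; case: z => s t /=; rewrite /rect/=.
  by move=> /andP[/andP[ms sb] ->] sm; rewrite sm (le_trans am ms).
- by rewrite /= am.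
Qed.

Let add2 a b c m d : c <= m -> m <= d -> a <= b ->
  Q a b c m -> Q a b m d -> Q a b c d.
Proof.
move=> cm md ab Q1 Q2 e pe; have [F1 [c1 l1 e1]] := Q1 e pe.
have am : rect a b c m (a, m) by rewrite /rect /= ab !lexx cm.
have [F2 [c2 l2 e2]] := Q2 (F1 (a, m)) (l1 _ am).
have agree t : a <= t <= b -> F1 (t, m) = F2 (t, m).
  move=> ct.
  apply: (lift_unique pcov (@connected_hline m a b) (g := F1) (g' := F2) _ _ _
    (z0 := (a, m))) => //.
  - by apply: continuous_subspaceW c1 => z [t' /= ht <-]; move: ht;
    rewrite /rect/= in_itv /= => ->; rewrite cm lexx.
  - by apply: continuous_subspaceW c2 => z [t' /= ht <-]; move: ht;
    rewrite /rect/= in_itv /= => ->; rewrite md lexx.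
  - move=> z [t' /=]; rewrite in_itv /= => h <-; rewrite l1 ?l2//.
      by rewrite /rect /= h lexx md.
    by rewrite /rect /= h lexx cm.
  - by exists a; rewrite //= in_itv /= lexx ab.
  - by exists t; rewrite //= in_itv.
exists (fun z => if z.2 <= m then F1 z else F2 z); split.
- rewrite (rect_split2 _ _ cm md);
  apply: (glue (test := fun z => z.2 <= m)) => //; try exact: closed_rect.
    by move=> z /andP[_ /andP[]].
  move=> [s t] /andP[/= ct /andP[ms _]] /= sm.
  have -> : t = m by lra.
  exact: agree.
- move=> z; rewrite (rect_split2 _ _ cm md) => -[] rz.
    by case/andP: (rz) => _ /andP[_ ->]; exact: l1.
  case: ifP => zm; last exact: l2.
  apply: l1; move: rz zm; case: z => s t /=; rewrite /rect/=.
  by move=> /andP[-> /andP[ms sb]] sm; rewrite sm (le_trans cm ms).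
- by rewrite /= cm.
Qed.

(** A small rectangle near [z0] is sent by [F] into an evenly covered set, where a section composed
    with [F] is a lift. *)
Let loc z0 : I z0.1 -> I z0.2 -> exists2 d, 0 < d & forall a b c d',
  0 <= a -> a <= b -> b <= 1 -> 0 <= c -> c <= d' -> d' <= 1 ->
  `|a - z0.1| < d -> `|b - z0.1| < d -> `|c - z0.2| < d -> `|d' - z0.2| < d ->
  Q a b c d'.
Proof.
move=> I1 I2; have [cp cov] := pcov.
have [U [oU Uz] [s [s1 s2 s3 s4 s5]]] := cov (F z0).
have /subspace_continuousP/(_ z0 (conj I1 I2))/(_ U (open_nbhs_nbhs (conj oU
  Uz))) := cF.
rewrite /= /within /= => -[[W1 W2] /= [W1n W2n] W].
have /nbhs_ballP[d1 /= d10 b1] := W1n.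
have /nbhs_ballP[d2 /= d20 b2] := W2n.
exists (Num.min d1 d2); first by rewrite lt_min d10 d20.
move=> a b c d' a0 ab b_1 c0 cd d1' ha hb hc hd e pe.
have inU z : rect a b c d' z -> I z.1 /\ I z.2 /\ U (F z).
  case: z => u v /andP[/= /andP[au ub] /andP[cv vd]].
  have Iu : I u by apply/unitP; split; lra.
  have Iv : I v by apply/unitP; split; lra.
  split=> //; split=> //; apply: W => //; split=> /=.
    apply: b1; rewrite /ball /= distrC.
    move: ha hb; rewrite !lt_min !ltr_norml => /andP[/andP[? ?] _]
      /andP[/andP[? ?] _].
    by apply/andP; split; lra.
  apply: b2; rewrite /ball /= distrC.
  move: hc hd; rewrite !lt_min !ltr_norml => /andP[_ /andP[? ?]] /andP[_
    /andP[? ?]].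
  by apply/andP; split; lra.
have rac : rect a b c d' (a, c) by rewrite /rect /= !lexx ab cd.
have Ue : U (p e) by rewrite pe; apply: (inU _ rac).2.2.
exists (s e \o F); split.
- apply: (within_comp (B := U)); last exact: s3.
    by apply: continuous_subspaceW cF => z /inU[? []].
  by move=> z /inU[_ []].
- by move=> z /inU[_ [_ ?]]; exact: s2.
- by rewrite /= -pe s1.
Qed.

Lemma square_lift e : p e = F (0, 0) -> exists F' : R * R -> E,
  [/\ {within I `*` I, continuous F'},
      forall z, (I `*` I) z -> p (F' z) = F z & F' (0, 0) = e].
Proof.
suff : Q 0 1 0 1 by rewrite -rect01; apply.
apply: (interval_ind (Q := fun a b => Q a b 0 1)); last first.
  by move=> a m b *; apply: (@add1 a m b).
move=> x Ix.
(* A vertical strip around [x] is lifted by a second induction, on the height. The width is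
   existential inside the predicate, so it may shrink each time two rectangles are stacked. *)
have : exists2 d, 0 < d & forall a b, 0 <= a -> a <= b -> b <= 1 ->
    `|a - x| < d -> `|b - x| < d -> Q a b 0 1.
  apply: (interval_ind (Q := fun c d' => exists2 d, 0 < d & forall a b,
    0 <= a -> a <= b -> b <= 1 -> `|a - x| < d -> `|b - x| < d -> Q a b c d')).
    move=> y Iy; have [d d0 h] := @loc (x, y) Ix Iy; exists d => // c d' *.
    by exists d => // *; exact: h.
  move=> c m d' c0 cm md d1 [e1 e10 h1] [e2 e20 h2].
  exists (Num.min e1 e2); first by rewrite lt_min e10.
  move=> a b a0 ab b1; rewrite !lt_min => /andP[? ?] /andP[? ?].
  by apply: (@add2 a b c m d') => //; [exact: h1|exact: h2].
by [].
Qed.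

End Squares.

(** * Fundamental groups of components *)

Section ComponentInclusion.
Variables (X : topologicalType) (x0 : X).

Definition cval (u : component x0) : X := sval u.

Lemma cval_inj : injective cval.
Proof. by move=> u v; exact: val_inj. Qed.

Lemma cval_continuous : continuous cval.
Proof. exact: initial_continuous. Qed.

Lemma cvalP (u : component x0) : connected_component [set: X] x0 (cval u).
Proof. exact: set_valP. Qed.

Lemma within_component (T : topologicalType) (A : set T) (c : T -> component
  x0) :
  {within A, continuous (cval \o c)} -> {within A, continuous c}.
Proof.
exact: (@continuous_comp_initial _ (subspace A) _ (@set_val X _) c).
Qed.

Lemma within_cval (T : topologicalType) (A : set T) (c : T -> component x0) :
  {within A, continuous c} -> {within A, continuous (cval \o c)}.
Proof.
move=> cc; apply: (within_comp (B := setT)) cc _ _ => //.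
exact/continuous_subspaceT/cval_continuous.
Qed.

(** The image of a connected set through [x0] stays in the component of [x0]; a value outside it,
    possible only off [A], is replaced by the base point. *)
Lemma component_lift (T : topologicalType) (A : set T) (c : T -> X) a0 :
  connected A -> {within A, continuous c} -> A a0 -> c a0 = x0 ->
  exists2 c' : T -> component x0, {within A, continuous c'} &
    forall t, A t -> cval (c' t) = c t.
Proof.
move=> cA cc Aa0 ca0.
have inC t : A t -> connected_component [set: X] x0 (c t).
  move=> At; rewrite -ca0; exists (c @` A); last by exists t.
  by split; [exists a0| |exact: connected_continuous_connected].
pose c' t : component x0 := if pselect (connected_component [set: X] x0 (c t))
  is left h
  then exist _ (c t) (mem_set h) else component_point x0.
have c'E t : A t -> cval (c' t) = c t.
  by move=> At; rewrite /c'; case: pselect => // -[]; exact: inC.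
exists c' => //; apply: within_component.
by apply: within_eq cc => t At; rewrite /= c'E.
Qed.

End ComponentInclusion.

Lemma component_map (X Y : topologicalType) (phi : X -> Y) (x0 : X) (y0 : Y) :
  continuous phi -> phi x0 = y0 ->
  exists2 psi : component x0 -> component y0, continuous psi &
    forall u, cval (psi u) = phi (cval u).
Proof.
move=> cphi phi0.
have inC u : connected_component [set: Y] y0 (phi (@cval X x0 u)).
  have [C [Cx0 _ cC] Cu] := cvalP u.
  exists (phi @` C); last by exists (cval u).
  split=> //; first by exists x0.
  by apply: connected_continuous_connected => //; exact: continuous_subspaceT.
pose psi (u : component x0) : component y0 := exist _ (phi (cval u)) (mem_set
  (inC u)).
exists psi => //.
apply: (@continuous_comp_initial _ _ _ (@set_val Y _) psi).
by move=> u; apply: (continuous_comp (@cval_continuous _ _ u)); exact: cphi.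
Qed.

(** * The unit interval, the unit square and loops *)

Section UnitLoops.
Local Open Scope ring_scope.
Variable R : realType.

Local Notation I := (`[0, 1]%classic : set R).

Lemma unit0 : I 0. Proof. by apply/unitP; rewrite lexx ler01. Qed.
Lemma unit1 : I 1. Proof. by apply/unitP; rewrite lexx ler01. Qed.

Lemma unit_connected : connected I.
Proof. exact: segment_connected. Qed.

(** A clopen part that meets a vertical or horizontal line of the square contains it, since its
    trace is clopen in the interval; two such lines join any two points. *)
Lemma square_connected : connected (I `*` I).
Proof.
move=> D D0 DO DC; apply/seteqP; split; first by case: DO => C _ ->;
  apply: subIsetl.
have [C1 oC1 DE1] := DO; have [C2 cC2 DE2] := DC.
have cc1 (a : R) : continuous (fun t : R => (a, t)).
  by apply: continuous_pair => z; [exact: cvg_cst|exact: cvg_id].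
have cc2 (a : R) : continuous (fun t : R => (t, a)).
  by apply: continuous_pair => z; [exact: cvg_id|exact: cvg_cst].
have vline a b : D (a, b) -> forall t, I t -> D (a, t).
  move=> Dab.
  have [[/= Ia Ib] _] : (I `*` I) (a, b) /\ C1 (a, b) by move: Dab; rewrite DE1.
  have sl : I `&` (fun t => D (a, t)) = I.
    apply: unit_connected; first by exists b.
    - exists ((fun t : R => (a, t)) @^-1` C1); first exact: (continuousP _).1.
      by rewrite DE1; apply/seteqP; split => t [It] => [[]|] //.
    - exists ((fun t : R => (a, t)) @^-1` C2);
      first exact: (continuous_closedP _).1.
      by rewrite DE2; apply/seteqP; split => t [It] => [[]|] //.
  by move=> t It; have : I t by []; rewrite -{1}sl => -[].
have hline a b : D (a, b) -> forall t, I t -> D (t, b).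
  move=> Dab.
  have [[/= Ia Ib] _] : (I `*` I) (a, b) /\ C1 (a, b) by move: Dab; rewrite DE1.
  have sl : I `&` (fun t => D (t, b)) = I.
    apply: unit_connected; first by exists a.
    - exists ((fun t : R => (t, b)) @^-1` C1); first exact: (continuousP _).1.
      by rewrite DE1; apply/seteqP; split => t [It] => [[]|] //.
    - exists ((fun t : R => (t, b)) @^-1` C2);
      first exact: (continuous_closedP _).1.
      by rewrite DE2; apply/seteqP; split => t [It] => [[]|] //.
  by move=> t It; have : I t by []; rewrite -{1}sl => -[].
case: D0 => -[a b] Dab [s t] [/= Is It].
exact: (hline a t (vline a b Dab t It)).
Qed.

Lemma concat_continuous (X : topologicalType) (c d : R -> X) :
  {within I, continuous c} -> {within I, continuous d} -> c 1 = d 0 ->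
  {within I, continuous (concat c d)}.
Proof.
move=> cc cd c1; rewrite unit_split.
have ci : continuous (id : R -> R) by move=> z; exact: cvg_id.
apply: withinU_continuous.
- by apply: closedI (@interval_closed _ _ _ _ _) (closed_le_half ci).1.
- by apply: closedI (@interval_closed _ _ _ _ _) (closed_le_half ci).2.
- apply: (@within_eq _ _ _ (c \o (fun t => 2 * t + 0))).
    by move=> z [_ /= zh]; rewrite /concat zh addr0.
  apply: (within_comp (B := I)) cc.
    exact/continuous_subspaceT/continuous_affine.
  by move=> t [/= /unitP[t0 t1] th]; apply/unitP; split; lra.
- apply: (@within_eq _ _ _ (d \o (fun t => 2 * t + -1))).
    move=> t [/= It ht]; rewrite /concat; case: ifP => // th.
    have -> : t = 2^-1 by lra.
    by rewrite mulfV ?pnatr_eq0// subrr c1.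
  apply: (within_comp (B := I)) cd.
    exact/continuous_subspaceT/continuous_affine.
  by move=> t [/= /unitP[t0 t1] th]; apply/unitP; split; lra.
Qed.

Lemma concat0 (X : topologicalType) (c d : R -> X) : concat c d 0 = c 0.
Proof. by rewrite /concat ifT ?invr_ge0// mulr0. Qed.

Lemma concat1 (X : topologicalType) (c d : R -> X) : concat c d 1 = d 1.
Proof.
by rewrite /concat ifF; [congr d; lra|lra].
Qed.

(** Loops are functions on all of [R], but only their values on the unit interval matter. *)
Lemma homotopic_eq (X : topologicalType) (x : X) (c d : loop R x) :
  (forall t, I t -> c t = d t) -> homotopic x c d.
Proof.
move=> cd; have [F [cF F0 F1 Fx]] := homotopic_refl d.
by exists F; split=> // t It; rewrite cd// F0.
Qed.

End UnitLoops.

Lemma pi1_class_mul (R : realType) (X : topologicalType) (x : X)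
    (c d : loop R x) :
  (pi1_class c * pi1_class d)%g = pi1_class (concat_loop c d).
Proof. exact: pi1_mulE. Qed.

(** * Induced maps on fundamental groups *)

Section InducedMap.
Variables (R : realType) (X Y : topologicalType) (phi : X -> Y) (x : X) (y : Y).
Hypotheses (cphi : continuous phi) (phix : phi x = y).

Lemma map_loop_subproof (c : loop R x) : `[< is_loop y (phi \o c) >].
Proof.
have [cc c0 c1] := asboolW (loopP c).
apply/asboolP; split; rewrite /= ?c0 ?c1//.
apply: (within_comp (B := setT)) cc _ _ => //; exact: continuous_subspaceT.
Qed.

Definition map_loop (c : loop R x) : loop R y := Loop (map_loop_subproof c).

Definition pi1_map (a : pi1 R x) : pi1 R y := pi1_class (map_loop (pi1_repr a)).

Lemma pi1_mapE (c : loop R x) : pi1_map (pi1_class c) = pi1_class (map_loop c).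
Proof.
apply/pi1_classP; have /pi1_classP[F [cF F0 F1 Fx]] := pi1_reprK (pi1_class c).
exists (phi \o F); split=> /=.
- apply: (within_comp (B := setT)) cF _ _ => //; exact: continuous_subspaceT.
- by move=> t It; rewrite F0.
- by move=> t It; rewrite F1.
- by move=> s Is; have [-> ->] := Fx s Is.
Qed.

Lemma pi1_mapM : {morph pi1_map : a b / (a * b)%g}.
Proof.
move=> a b; rewrite -(pi1_reprK a) -(pi1_reprK b).
move: (pi1_repr a) (pi1_repr b) => {}a {}b.
rewrite pi1_class_mul !pi1_mapE pi1_class_mul; congr pi1_class; apply: val_inj.
by apply/funext => t /=; rewrite /concat /=; case: ifP.
Qed.

HB.instance Definition _ :=
  isMultiplicative.Build (pi1 R x) (pi1 R y) pi1_map pi1_mapM.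

End InducedMap.

(** * Monodromy and the fundamental group of a covering *)

Section CoveringPi1.
Local Open Scope ring_scope.
Variables (R : realType) (E B : topologicalType) (p : E -> B).
Hypothesis pcov : covering_map p.
Variables (e0 : E) (b0 : B).
Hypothesis pe0 : p e0 = b0.

Local Notation I := (`[0, 1]%classic : set R).
Local Notation base := (component_point b0).

(** The path is extended to the square, constant in the first coordinate, and the lifted square is
    restricted to a side. *)
Lemma path_lift (c : R -> B) : {within I, continuous c} -> c 0 = b0 ->
  exists c' : R -> E, [/\ {within I, continuous c'},
    forall t, I t -> p (c' t) = c t & c' 0 = e0].
Proof.
move=> cc c0.
have [| |F [cF pF F0]] := @square_lift R _ _ p pcov (c \o snd) _ e0.
- apply: (within_comp (B := I)) cc; last by move=> z [].
  exact/continuous_subspaceT/continuous_snd.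
- by rewrite /= c0.
exists (fun t => F (0, t)); split=> //; last first.
  by move=> t It; rewrite pF//; split=> //=; exact: unit0.
apply: (within_comp (B := I `*` I)) cF; last by move=> t It; split=> //=;
  exact: unit0.
by apply/continuous_subspaceT/continuous_pair => t;
  [exact: cvg_cst|exact: cvg_id].
Qed.

Definition lifts_to (c : R -> component b0) (e : E) : Prop :=
  exists c' : R -> E, [/\ {within I, continuous c'},
    forall t, I t -> p (c' t) = cval (c t), c' 0 = e0 & c' 1 = e].

Lemma lifts_to_exists (c : loop R base) : exists e, lifts_to c e.
Proof.
have [cc c0 c1] := asboolW (loopP c).
have [|c' [cc' pc' c'0]] := path_lift (within_cval cc); first by rewrite /= c0.
by exists (c' 1), c'.
Qed.

Lemma lifts_to_proj (c : loop R base) e : lifts_to c e -> p e = b0.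
Proof.
have [cc c0 c1] := asboolW (loopP c).
by move=> [c' [_ pc' _ <-]]; rewrite pc' ?c1//; exact: unit1.
Qed.

(** The sides where [F] is constant lift to constant paths, because a constant path is also a lift
    and lifts are unique. *)
Lemma square_lift_sides (F : R * R -> component b0) :
  {within I `*` I, continuous F} ->
  (forall s, I s -> F (s, 0) = base /\ F (s, 1) = base) ->
  exists F' : R * R -> E, [/\ {within I `*` I, continuous F'},
    forall z, (I `*` I) z -> p (F' z) = cval (F z),
    forall s, I s -> F' (s, 0) = e0 & forall s, I s -> F' (s, 1) = F' (0, 1)].
Proof.
move=> cF Fx; have I0 := unit0 R; have I1 := unit1 R.
have [| |F' [cF' pF' F'0]] := @square_lift R _ _ p pcov (cval (x0:=b0) \o F) _
  e0.
- exact: within_cval.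
- by rewrite /= (Fx _ I0).1.
exists F'; have line u : u = 0 \/ u = 1 -> forall s, I s -> F' (s, u) = F' (0,
  u).
  move=> u01 s Is.
  have Iu : I u by case: u01 => ->.
  have cu : {within I, continuous (fun s : R => F' (s, u))}.
    apply: (within_comp (B := I `*` I)) cF'; last by move=> t It; split.
    by apply/continuous_subspaceT/continuous_pair => t;
      [exact: cvg_id|exact: cvg_cst].
  apply: (lift_unique pcov (@unit_connected R) cu _ _ I0 _ Is) => //.
    by apply/continuous_subspaceT => t; exact: cvg_cst.
  move=> z Iz; rewrite !pF' //=; case: u01 => ->.
    by rewrite (Fx _ Iz).1 (Fx _ I0).1.
  by rewrite (Fx _ Iz).2 (Fx _ I0).2.
split=> //.
- by move=> s Is; rewrite line//; left.
- by move=> s Is; rewrite line//; right.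
Qed.

Lemma path_lift_unique (c c' : R -> E) : {within I, continuous c} ->
  {within I, continuous c'} -> (forall t, I t -> p (c t) = p (c' t)) ->
  c 0 = c' 0 -> forall t, I t -> c t = c' t.
Proof.
move=> cc cc' pcc' c0.
exact: (lift_unique pcov (@unit_connected R) cc cc' pcc' (unit0 R) c0).
Qed.

Lemma square_lift_side (F' : R * R -> E) (s : R) : I s ->
  {within I `*` I, continuous F'} -> {within I, continuous (fun t => F' (s,
    t))}.
Proof.
move=> Is; apply: within_comp; last by move=> t It; split.
by apply/continuous_subspaceT/continuous_pair => t;
  [exact: cvg_cst|exact: cvg_id].
Qed.

(** The lifts of [c] and [d] are opposite sides of the lifted homotopy, and the side that joins
    their ends is constant. *)
Lemma lifts_to_homotopic (c d : R -> component b0) e e' :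
  homotopic base c d -> lifts_to c e -> lifts_to d e' -> e = e'.
Proof.
move=> [F [cF F0 F1 Fx]] [c' [cc' pc' c'0 <-]] [d' [cd' pd' d'0 <-]].
have I0 := unit0 R; have I1 := unit1 R.
have [F' [cF' pF' F'0 F'1]] := square_lift_sides cF Fx.
have -> : c' 1 = F' (0, 1).
  apply: (path_lift_unique cc' (square_lift_side I0 cF')) => //.
    by move=> t It; rewrite pc'// pF'// F0.
  by rewrite c'0 F'0.
have -> : d' 1 = F' (1, 1).
  apply: (path_lift_unique cd' (square_lift_side I1 cF')) => //.
    by move=> t It; rewrite pd'// pF'// F1.
  by rewrite d'0 F'0.
by rewrite F'1.
Qed.

(** By [monodromy_class] the choice of the representative is immaterial; the relation is functional
    by [monodromy_exists] and [monodromy_inj]. *)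
Definition monodromy (a : pi1 R base) (e : E) : Prop := lifts_to (pi1_repr a) e.

Lemma monodromy_class (c : loop R base) e :
  monodromy (pi1_class c) e <-> lifts_to c e.
Proof.
have h : homotopic base (pi1_repr (pi1_class c)) c.
  by apply/pi1_classP; exact: pi1_reprK.
have [e1 l1] := lifts_to_exists (pi1_repr (pi1_class c)).
have [e2 l2] := lifts_to_exists c.
split=> l.
  by rewrite (lifts_to_homotopic h l l2).
by rewrite -(lifts_to_homotopic h l1 l).
Qed.

Lemma monodromy_inj a e e' : monodromy a e -> monodromy a e' -> e = e'.
Proof. by apply: lifts_to_homotopic; exact: homotopic_refl. Qed.

Lemma monodromy_exists a : exists e, monodromy a e.
Proof. exact: lifts_to_exists. Qed.

Lemma monodromy_proj a e : monodromy a e -> p e = b0.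
Proof. exact: lifts_to_proj. Qed.

(** [T] commutes with the projection and moves [e0] to the end of the lift of [a]; hence it carries
    the lift of [b] to a lift that continues that of [a]. *)
Lemma monodromy_mul (T : E -> E) a b e e' : continuous T ->
  (forall z, p (T z) = p z) -> T e0 = e ->
  monodromy a e -> monodromy b e' -> monodromy (a * b)%g (T e').
Proof.
move=> cT pT Te0.
rewrite -(pi1_reprK a) -(pi1_reprK b);
  move: (pi1_repr a) (pi1_repr b) => {}a {}b.
have I0 := unit0 R; have I1 := unit1 R.
rewrite pi1_class_mul !monodromy_class => -[a' [ca' pa' a'0 a'1]] [b' [cb' pb'
  b'0 b'1]].
exists (concat a' (T \o b')); split.
- apply: concat_continuous => //; last by rewrite /= a'1 b'0.
  by apply: (within_comp (B := setT)) cb' _ _ => //;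
    exact: continuous_subspaceT.
- move=> t /unitP[t0 t1]; rewrite /concat /= /concat; case: ifP => th /=.
    by rewrite pa'//; apply/unitP; split; lra.
  by rewrite pT pb'//; apply/unitP; split; lra.
- by rewrite concat0.
- by rewrite concat1 /= b'1.
Qed.

(** The loop is the projection of [c], and [c] is its lift. *)
Lemma monodromy_of_path (c : R -> E) : {within I, continuous c} -> c 0 = e0 ->
  p (c 1) = b0 -> exists a, monodromy a (c 1).
Proof.
move=> cc c0 c1; have [cp _] := pcov.
have cpc : {within I, continuous (p \o c)}.
  by apply: (within_comp (B := setT)) cc _ _ => //; exact: continuous_subspaceT.
have pc0 : (p \o c) 0 = b0 by rewrite /= c0.
have [d cd dE] := component_lift (@unit_connected R) cpc (unit0 R) pc0.
have d0 : d 0 = base by apply: cval_inj; rewrite (dE _ (unit0 R)) pc0.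
have d1 : d 1 = base by apply: cval_inj; rewrite (dE _ (unit1 R)) /= c1.
have dP : `[< is_loop base d >] by apply/asboolP.
exists (pi1_class (Loop dP)); apply/monodromy_class.
by exists c; split=> // t It; rewrite /= dE.
Qed.

(** Injectivity: a homotopy between projected loops lifts, and by uniqueness of lifts its sides are
    the original loops. Image: a loop whose lift closes up is the projection of that lift. *)
Lemma covering_pi1 : exists i : {multiplicative pi1 R (component_point e0) ->
  pi1 R base},
  injective i /\ range i = [set a | monodromy a e0].
Proof.
have [cp _] := pcov; have I0 := unit0 R; have I1 := unit1 R.
have [psi cpsi psiE] := component_map cp pe0.
have psi0 : psi (component_point e0) = base by apply: cval_inj; rewrite psiE.
exists (pi1_map cpsi psi0); split.
- move=> a b; rewrite -(pi1_reprK a) -(pi1_reprK b).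
  move: (pi1_repr a) (pi1_repr b) => {}a {}b.
  rewrite /= !pi1_mapE => /pi1_classP[F [cF F0 F1 Fx]]; apply/pi1_classP.
  have [ca a0 a1] := asboolW (loopP a); have [cb b_0 b1] := asboolW (loopP b).
  have [F' [cF' pF' F'0 F'1]] := square_lift_sides cF Fx.
  have F'a t : I t -> F' (0, t) = cval (a t).
    apply: (path_lift_unique (square_lift_side I0 cF') (within_cval ca)) => //=.
      by move=> {}t It; rewrite pF'// F0// psiE.
    by rewrite F'0// a0.
  have F'b t : I t -> F' (1, t) = cval (b t).
    apply: (path_lift_unique (square_lift_side I1 cF') (within_cval cb)) => //=.
      by move=> {}t It; rewrite pF'// F1// psiE.
    by rewrite F'0// b_0.
  have [F2 cF2 F2E] := component_lift (@square_connected R) cF'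
    (conj I0 I0 : (I `*` I) (0, 0)) (F'0 0 I0).
  exists F2; split=> //.
  + by move=> t It; apply: cval_inj; rewrite F2E// F'a.
  + by move=> t It; apply: cval_inj; rewrite F2E// F'b.
  + move=> s Is; split; apply: cval_inj; rewrite F2E// ?F'0//.
    by rewrite F'1// F'a// a1.
- apply/seteqP; split=> [_ [a _ <-]|a /=]; rewrite /= -(pi1_reprK a);
    move: (pi1_repr a) => {}a.
    have [ca a0 a1] := asboolW (loopP a).
    rewrite pi1_mapE; apply/monodromy_class.
    by exists (@cval _ _ \o a); split; [exact: within_cval|
      move=> t It; rewrite /= psiE|rewrite /= a0|rewrite /= a1].
  move=> /monodromy_class[c [cc pc c0 c1]].
  have [d cd dE] := component_lift (@unit_connected R) cc I0 c0.
  have dP : `[< is_loop (component_point e0) d >].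
    by apply/asboolP; split=> //; apply: cval_inj; rewrite dE.
  exists (pi1_class (Loop dP)) => //; rewrite pi1_mapE; apply/pi1_classP.
  by apply: homotopic_eq => t It /=; apply: cval_inj; rewrite psiE dE// pc.
Qed.

End CoveringPi1.

(** * Realizations of order complexes *)

Section Realization.
Local Open Scope fset_scope.
Local Open Scope ring_scope.
Variable R : realType.

Local Notation rlz P := (realization R (@order_complex _ P)).
Local Notation pt := (order_complex_point R).

Section Points.
Context {d : Order.disp_t} {P : porderType d}.
Implicit Types (t u : rlz P) (x y : P) (s : {fset P}).

Lemma rlz_simplex t : exists2 s, order_complex s & in_simplex s t.
Proof. exact: asboolW (coordP t). Qed.

Lemma rlz_ge0 t x : 0 <= t x.
Proof. by have [s _ []] := rlz_simplex t. Qed.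

Lemma rlz_gt0 t x : t x != 0 -> 0 < t x.
Proof. by rewrite lt_def rlz_ge0 andbT. Qed.

Lemma in_simplex_mem s t x : in_simplex s t -> 0 < t x -> x \in s.
Proof.
move=> [_ t0 _] tx; apply/negPn/negP => /t0 e.
by rewrite e ltxx in tx.
Qed.

Lemma rlz_chain t x y : 0 < t x -> 0 < t y -> (x >=< y)%O.
Proof.
have [s [_ ch] st] := rlz_simplex t.
by move=> /(in_simplex_mem st) xs /(in_simplex_mem st) ys; exact: ch.
Qed.

Lemma rlz_supp t : exists x, 0 < t x.
Proof.
have [s _ [t0 tN t1]] := rlz_simplex t.
apply: contrapT => h; have : \sum_(x <- s) t x = 0.
  apply: big1 => x _; apply: contrapT => /eqP /rlz_gt0 tx; apply: h;
    by exists x.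
by rewrite t1 => /eqP; rewrite oner_eq0.
Qed.

Lemma rlz_ext t u : (forall x, t x = u x) -> t = u.
Proof. by move=> tu; apply: val_inj; apply/funext. Qed.

Lemma rlz_exists s (c : P -> R) : order_complex s -> in_simplex s c ->
  exists t : rlz P, t = c :> (P -> R).
Proof.
move=> Ks sc; have cP : `[< exists2 s, order_complex s & in_simplex s c >].
  by apply/asboolP; exists s.
by exists (Realization cP).
Qed.

Lemma pt_gt0 x y : (0 < pt x y) = (y == x).
Proof. by rewrite /=; case: eqP => _; rewrite ?ltr01 ?ltxx. Qed.

Lemma rlz_openE (U : set (rlz P)) : open U = realization_open U.
Proof. by []. Qed.

Lemma pt_inj : injective (pt : P -> rlz P).
Proof. by move=> x y xy; apply/eqP; rewrite -pt_gt0 -xy pt_gt0. Qed.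

Lemma open_star x : open [set t : rlz P | 0 < t x].
Proof.
rewrite rlz_openE => s Ks t st /= tx; exists (t x) => // u _ tu.
have := tu x; rewrite ltr_norml => /andP[_]; lra.
Qed.

(** The path runs along the edge spanned by [x] and [y], with barycentric coordinates [co]. *)
Lemma pt_path x y : (x >=< y)%O -> exists c : R -> rlz P,
  [/\ {within `[0, 1], continuous c}, c 0 = pt x & c 1 = pt y].
Proof.
move=> xy; pose s := [fset x; y].
have Ks : order_complex s.
  split; first by apply/fset0Pn; exists x; rewrite !inE eqxx.
  by move=> a b; rewrite !inE => /orP[] /eqP-> /orP[] /eqP->;
    rewrite ?comparablexx// comparable_sym.
pose co (t : R) (z : P) : R := (1 - t) * (z == x)%:R + t * (z == y)%:R.
have sx (z : P) : z \in s -> \sum_(a <- s) (a == z)%:R = 1 :> R.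
  move=> zs; rewrite (big_fsetD1 z)//= eqxx big1_fset ?addr0//.
  by move=> i; rewrite !inE => /andP[/negbTE->].
have cos (t : R) : 0 <= t -> t <= 1 -> in_simplex s (co t).
  move=> t0 t1; split.
  - by move=> z; rewrite addr_ge0// mulr_ge0 ?ler0n//; lra.
  - move=> z; rewrite !inE negb_or /co => /andP[/negbTE-> /negbTE->].
    by rewrite !mulr0 addr0.
  - by rewrite big_split /= -!mulr_sumr !sx ?inE ?eqxx ?orbT//; lra.
have /choice[c cE] : forall t : R, exists u : rlz P, 0 <= t <= 1 -> u = co t :>
  (P -> R).
  move=> t; case: (boolP (0 <= t <= 1)) => [/andP[t0 t1]|_];
    last by exists (pt x).
  by have [u uE] := rlz_exists Ks (cos t t0 t1); exists u.
exists c; split.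
- apply/subspace_continuousP => t; rewrite /= in_itv /= => t01.
  move=> U /=; rewrite nbhsE => -[V [oV Vt] VU]; rewrite /within /=.
  have sct : in_simplex s (c t) by rewrite cE//; case/andP: t01; exact: cos.
  have [e e0 eV] := oV s Ks (c t) sct Vt.
  apply/nbhs_ballP; exists (e / 2) => /=; first by rewrite divr_gt0.
  move=> t' tt'; rewrite in_itv /= => t'01; apply/VU/eV.
    by rewrite cE//; case/andP: t'01; exact: cos.
  move=> z; rewrite !cE// /co.
  (* Each coordinate is 1-Lipschitz in the parameter; this gives continuity for the weak topology,
     as the path stays in the simplex [s]. *)
  have -> : (1 - t) * (z == x)%:R + t * (z == y)%:R -
     ((1 - t') * (z == x)%:R + t' * (z == y)%:R) =
     (t - t') * ((z == y)%:R - (z == x)%:R) :> R by lra.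
  rewrite normrM; move: tt'; rewrite /ball /= => tt'.
  have h1 : `|(z == y)%:R - (z == x)%:R| <= 1 :> R.
    by do 2 case: eqP => _; rewrite ?subrr ?subr0 ?sub0r ?normrN ?normr0
      ?normr1 ?ler01.
  have h2 : `|t - t'| * `|(z == y)%:R - (z == x)%:R| <= `|t - t'| * 1 :> R.
    by rewrite ler_wpM2l.
  have : e / 2 * 2 = e by rewrite divfK ?pnatr_eq0.
  by move: h2 tt'; lra.
- by apply: rlz_ext => z; rewrite cE ?lexx ?ler01// /co /= ; lra.
- by apply: rlz_ext => z; rewrite cE ?lexx ?ler01// /co /= ; lra.
Qed.

(** The points with a supporting vertex reachable from [x] form a clopen part: open stars are open,
    and the supporting vertices of a point are comparable. *)
Lemma component_zigzag x y : connected_component [set: rlz P] (pt x) (pt y) ->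
  clos_refl_trans _ (fun a b : P => (a >=< b)%O) x y.
Proof.
move=> [C [Cx _ cC] Cy].
pose D t := exists2 z, clos_refl_trans _ (fun a b : P => (a >=< b)%O) x z & 0 <
  t z.
suff [z xz] : D (pt y) by rewrite pt_gt0 => /eqP <-.
apply: (connected_ind cC (P := D)) Cx _ _ Cy.
- move=> t Ct [z xz tz]; have := open_nbhs_nbhs (conj (open_star (x := z)) tz).
  by move=> n; apply: cvg_within; apply: filterS n => u uz; exists z.
- move=> t Ct ND; have [z tz] := rlz_supp t.
  have := open_nbhs_nbhs (conj (open_star (x := z)) tz).
  move=> n; apply: cvg_within; apply: filterS n => u uz [z' xz' uz']; apply: ND.
  exists z => //; apply: rt_trans xz' _; apply: rt_step;
    exact: rlz_chain uz' uz.
- by exists x; [exact: rt_refl|rewrite pt_gt0].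
Qed.

End Points.

(** * Maps of realizations induced by monotone maps *)

Section Push.
Context {d d' : Order.disp_t} {P : porderType d} {Q : porderType d'}.
Variable q : P -> Q.
Hypothesis qmono : {homo q : x y / (x <= y)%O}.

Lemma homo_comparable : {homo q : x y / (x >=< y)%O}.
Proof.
by move=> x y /orP[] /qmono; rewrite /Order.comparable => ->; rewrite ?orbT.
Qed.

Lemma image_chain s : order_complex s -> order_complex (q @` s).
Proof.
move=> [/fset0Pn[x xs] ch]; split.
  by apply/fset0Pn; exists (q x); rewrite in_imfset.
by move=> _ _ /imfsetP[a /= sa ->] /imfsetP[b /= sb ->];
  apply/homo_comparable/ch.
Qed.

(** [P] may be infinite, so coordinates are summed over a simplex that contains [t]; they vanish off
    it, so the choice of the simplex does not matter. *)
Lemma push_exists (t : rlz P) : exists u : rlz Q,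
  forall s, in_simplex s t -> forall y, u y = \sum_(x <- s | q x == y) t x.
Proof.
have [s Ks st] := rlz_simplex t; have [t0 tN t1] := st.
have indep s' y : in_simplex s' t -> \sum_(x <- s | q x == y) t x =
    \sum_(x <- s' | q x == y) t x.
  move=> [_ tN' _]; rewrite !(big_mkcond (fun x => q x == y)).
  rewrite (big_fset_incl _ (fsubsetUl s s')).
    rewrite (big_fset_incl _ (fsubsetUr s s'))// => x _ /tN' ->; by case: ifP.
  by move=> x _ /tN ->; case: ifP.
have [|u uE] := rlz_exists (c := fun y => \sum_(x <- s | q x == y) t x)
  (image_chain Ks).
  split.
  - by move=> y; apply: sumr_ge0 => x _; exact: t0.
  - move=> y yN; rewrite big_seq_cond big1// => x /andP[xs /eqP xy].
    by move: yN; rewrite -xy in_imfset.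
  - by rewrite -partition_big_imfset.
by exists u => s' s't y; rewrite uE (indep s').
Qed.

Definition push (t : rlz P) : rlz Q := sval (cid (push_exists t)).

Lemma pushE s (t : rlz P) y : in_simplex s t ->
  push t y = \sum_(x <- s | q x == y) t x.
Proof. by move=> st; rewrite /push; case: cid => u /= /(_ s st y). Qed.

Lemma push_gt0 (t : rlz P) x : 0 < t x -> 0 < push t (q x).
Proof.
move=> tx; have [s Ks st] := rlz_simplex t.
rewrite (pushE _ st) big_mkcond (bigD1_seq x) ?fset_uniq//=; last first.
  exact: in_simplex_mem tx.
rewrite eqxx ltr_wpDr// sumr_ge0// => y _; case: ifP => // _; exact: rlz_ge0.
Qed.

Lemma push_supp (t : rlz P) y : 0 < push t y -> exists2 x, q x = y & 0 < t x.
Proof.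
have [s Ks st] := rlz_simplex t; rewrite (pushE _ st) => p0.
apply: contrapT => h; move: p0; rewrite big1 ?ltxx// => x /eqP qx.
by apply: contrapT => /eqP /rlz_gt0 tx; apply: h; exists x.
Qed.

Lemma in_simplex_push s (t : rlz P) : order_complex s -> in_simplex s t ->
  in_simplex (q @` s) (push t).
Proof.
move=> Ks st; split.
- by move=> y; exact: rlz_ge0.
- move=> y; apply: contraNeq => /rlz_gt0 /push_supp[x <- tx].
  by rewrite in_imfset //=; exact: in_simplex_mem tx.
- have [_ _ <-] := st.
  rewrite [RHS](partition_big_imfset _ q); apply: eq_bigr => y _; exact: pushE.
Qed.

Lemma push_inj (s : {fset P}) (t : rlz P) x : {in s &, injective q} ->
  in_simplex s t -> x \in s -> push t (q x) = t x.
Proof.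
move=> qi st xs; rewrite (pushE _ st) big_mkcond (bigD1_seq x) ?fset_uniq//=
  eqxx.
rewrite big_seq_cond big1 ?addr0// => y /andP[ys /eqP yx].
by case: eqP => // /(qi _ _ ys xs).
Qed.

Lemma push_continuous : continuous push.
Proof.
apply/continuousP => V; rewrite !rlz_openE => oV s Ks t st /= Vt.
have [e e0 eV] := oV _ (image_chain Ks) _ (in_simplex_push Ks st) Vt.
(* Each coordinate of the image is a sum of at most [size s] terms, each known within [e / n]; the
   successor makes [n] positive and the final bound strict. *)
pose n : R := (size s).+1%:R.
have n0 : 0 < n by rewrite ltr0n.
exists (e / n); first by rewrite divr_gt0.
move=> u su tu; apply: eV; first exact: in_simplex_push.
move=> y; rewrite (pushE _ st) (pushE _ su) -sumrB.
apply: (le_lt_trans (ler_norm_sum _ _ _)).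
apply: (@le_lt_trans _ _ (\sum_(x <- s) e / n)).
  rewrite big_mkcond /=; apply: ler_sum => x _; case: ifP => _.
    exact/ltW/tu.
  by rewrite divr_ge0 // ltW.
rewrite big_const_seq count_predT iter_addr_0 -mulr_natl mulrA.
by rewrite ltr_pdivrMr// mulrC ltr_pM2l// ltr_nat.
Qed.

Lemma push_pt x : push (pt x) = pt (q x).
Proof.
have sx : in_simplex [fset x] (pt x).
  split; [exact: rlz_ge0|by move=> y; rewrite inE /= => /negbTE->|].
  by rewrite big_seq_fset1 /= eqxx.
apply: rlz_ext => y; rewrite (pushE _ sx) big_mkcond big_seq_fset1 /= eqxx.
by rewrite eq_sym; case: eqP.
Qed.

End Push.

Lemma push_comp {d d' : Order.disp_t} {P : porderType d} {Q : porderType d'}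
    (q : P -> Q) (T : P -> P) (qmono : {homo q : x y / (x <= y)%O})
    (Tmono : {homo T : x y / (x <= y)%O}) (t : rlz P) :
  injective T -> (forall x, q (T x) = q x) ->
  push qmono (push Tmono t) = push qmono t.
Proof.
move=> Ti qT; have [s Ks st] := rlz_simplex t.
apply: rlz_ext => y; rewrite (pushE qmono y st).
rewrite (pushE qmono y (in_simplex_push Tmono Ks st)).
rewrite big_mkcond big_imfset /=; last by move=> a b _ _; exact: Ti.
rewrite [RHS]big_mkcond big_seq [RHS]big_seq; apply: eq_bigr => x xs.
by rewrite qT (push_inj _ _ st xs)// => a b _ _; exact: Ti.
Qed.

End Realization.

(** * Coverings of posets *)

Section PosetCovering.
Local Open Scope fset_scope.
Local Open Scope ring_scope.
Context {d d' : Order.disp_t} {P : porderType d} {Q : porderType d'}.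
Variable q : P -> Q.

Definition poset_covering : Prop :=
  [/\ {homo q : x y / (x <= y)%O},
      forall x y, (q x <= y)%O -> exists2 z, (x <= z)%O & q z = y,
      forall x y, (y <= q x)%O -> exists2 z, (z <= x)%O & q z = y,
      forall x z z', (x <= z)%O -> (x <= z')%O -> q z = q z' -> z = z' &
      forall x z z', (z <= x)%O -> (z' <= x)%O -> q z = q z' -> z = z'].

Hypothesis qcov : poset_covering.

Lemma poset_covering_homo : {homo q : x y / (x <= y)%O}.
Proof. by case: qcov. Qed.

Lemma comparable_lift x y : (y >=< q x)%O -> exists2 z, (z >=< x)%O & q z = y.
Proof.
have [_ up dn _ _] := qcov.
by move=> /orP[/dn|/up] [z xz qz]; exists z;
  rewrite // /Order.comparable xz ?orbT.
Qed.

(** If [z] and [z'] lie on opposite sides of [x], they are comparable and both lie above the smaller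
    one, where upward uniqueness applies. *)
Lemma comparable_lift_inj x z z' : (z >=< x)%O -> (z' >=< x)%O ->
  q z = q z' -> z = z'.
Proof.
have [_ _ _ ui di] := qcov.
move=> /orP[zx|xz] /orP[z'x|xz'] qz.
- exact: (di x).
- exact/esym/(ui z z' z (le_trans zx xz') (lexx _) (esym qz)).
- exact: (ui z' z z' (le_trans z'x xz) (lexx _) qz).
- exact: (ui x).
Qed.

(** The inequality is lifted from one end, and uniqueness identifies the other end. With
    [comparable_lift] and [comparable_lift_inj], [q] is an order isomorphism from the elements
    comparable with [x] to those comparable with [q x]. *)
Lemma comparable_lift_le x z z' : (z >=< x)%O -> (z' >=< x)%O ->
  (q z <= q z')%O -> (z <= z')%O.
Proof.
have [_ up dn _ _] := qcov.
move=> zx z'x qz.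
case/orP: (zx) => h.
- case/orP: (z'x) => h'; last exact: le_trans h h'.
  have [w wz' qw] := dn z' (q z) qz.
  suff <- : w = z by [].
  apply: (@comparable_lift_inj x) => //.
  by rewrite /Order.comparable (le_trans wz' h').
- have [w zw qw] := up z (q z') qz.
  suff <- : w = z' by [].
  apply: (@comparable_lift_inj x) => //.
  by rewrite /Order.comparable (le_trans h zw) orbT.
Qed.

(** Each member of [s] lifts to an element comparable with [x]; the lifts form a chain since [q]
    reflects the order among them. *)
Lemma chain_lift (s : {fset Q}) x : order_complex s -> q x \in s ->
  exists s' : {fset P}, [/\ order_complex s', x \in s',
    {in s' &, injective q} & q @` s' = s].
Proof.
move=> [_ ch] xs.
have /choice[L LP] : forall y, exists z, y \in s -> (z >=< x)%O /\ q z = y.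
  move=> y; case: (boolP (y \in s)) => [ys|_]; last by exists x.
  by have [z zx qz] := comparable_lift (ch _ _ ys xs); exists z.
have Lx : L (q x) = x.
  have [c e] := LP _ xs; apply: (@comparable_lift_inj x) => //;
    exact: comparablexx.
have xs' : x \in L @` s by apply/imfsetP; exists (q x).
exists (L @` s); split=> //.
- split; first by apply/fset0Pn; exists x.
  move=> _ _ /imfsetP[a /= sa ->] /imfsetP[b /= sb ->].
  have [ca ea] := LP _ sa; have [cb eb] := LP _ sb.
  have /orP[ab|ba] := ch _ _ sa sb; apply/orP; [left|right];
    by apply: (@comparable_lift_le x) => //; rewrite ea eb.
- move=> _ _ /imfsetP[a /= sa ->] /imfsetP[b /= sb ->].
  by have [_ ->] := LP _ sa; have [_ ->] := LP _ sb => ->.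
- apply/fsetP => y; apply/imfsetP/idP => [[_ /imfsetP[a /= sa ->] ->]|ys].
    by have [_ ->] := LP _ sa.
  by exists (L y); [exact: in_imfset|have [_ ->] := LP _ ys].
Qed.

Variable R : realType.

Local Notation rlz P := (realization R (@order_complex _ P)).
Local Notation push := (push poset_covering_homo).

Lemma chain_inj (t : rlz P) x y : 0 < t x -> 0 < t y -> q x = q y -> x = y.
Proof.
move=> tx ty; apply: (@comparable_lift_inj x); first exact: comparablexx.
exact: rlz_chain ty tx.
Qed.

Lemma push_supp_eq (t : rlz P) x : 0 < t x -> push t (q x) = t x.
Proof.
move=> tx; have [s [s0 ch] st] := rlz_simplex t.
apply: (push_inj _ _ st) (in_simplex_mem st tx) => a b sa sb.
by apply: (@comparable_lift_inj a); [exact: comparablexx|exact: ch].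
Qed.

(** All vertices of [t] and [u] are comparable with [x], and [q] is injective on such elements, so
    [push] keeps all the coordinates apart. *)
Lemma push_star_inj (t u : rlz P) x : push t = push u -> 0 < t x -> 0 < u x ->
  t = u.
Proof.
have H (t' u' : rlz P) z : push t' = push u' -> 0 < t' x -> 0 < u' x -> 0 < t'
  z -> t' z = u' z.
  move=> tu tx ux tz.
  have : 0 < push u' (q z) by rewrite -tu push_gt0.
  move=> /push_supp[z' qz u'z'].
  have zz' : z = z'.
    exact: comparable_lift_inj (rlz_chain tz tx) (rlz_chain u'z' ux) (esym qz).
  by subst z'; rewrite -(push_supp_eq u'z') -tu push_supp_eq.
move=> tu tx ux; apply: rlz_ext => z.
have [tz0|/rlz_gt0 tz] := eqVneq (t z) 0; last exact: H.
have [->|/rlz_gt0 uz] := eqVneq (u z) 0; first by [].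
exact: esym (H _ _ _ (esym tu) ux tx uz).
Qed.

Lemma simplex_lift (s : {fset Q}) (s' : {fset P}) (u : rlz Q) :
  order_complex s' -> {in s' &, injective q} -> q @` s' = s -> in_simplex s u ->
  exists t : rlz P, [/\ in_simplex s' t, forall x, x \in s' -> t x = u (q x) &
    push t = u].
Proof.
move=> Ks' qi qs [u0 uN u1].
pose c x := if x \in s' then u (q x) else 0.
have sc : in_simplex s' c.
  split.
  - by move=> x; rewrite /c; case: ifP.
  - by move=> x /negbTE xN; rewrite /c xN.
  - rewrite -u1 -qs big_imfset//= [LHS]big_seq [RHS]big_seq.
    by apply: eq_bigr => x xs; rewrite /c xs.
have [t tE] := rlz_exists Ks' sc.
have st : in_simplex s' t by rewrite tE.
have tu x : x \in s' -> t x = u (q x) by move=> xs; rewrite tE /c xs.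
exists t; split=> //.
apply: rlz_ext => y; have [ys|yNs] := boolP (y \in s).
  move: ys; rewrite -qs => /imfsetP[x /= xs ->].
  by rewrite (push_inj _ qi st xs) tu.
rewrite uN//; apply: contraNeq yNs => /rlz_gt0/push_supp[x <- tx].
by rewrite -qs in_imfset //=; exact: in_simplex_mem tx.
Qed.

Lemma push_fiber (t : rlz P) y : push t = order_complex_point R y ->
  exists2 x, q x = y & t = order_complex_point R x.
Proof.
move=> tE; have : 0 < push t y by rewrite tE pt_gt0.
move=> /push_supp[x qx tx]; exists x => //.
by apply: (@push_star_inj _ _ x); rewrite ?tE ?push_pt ?qx ?pt_gt0.
Qed.

(** The open star of a vertex [y] is evenly covered; the sheet through [e] is the open star of the
    only vertex of [e] above [y]. *)
Lemma push_covering_map : covering_map (push : rlz P -> rlz Q).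
Proof.
split; first exact: push_continuous.
move=> b; have [y by0] := rlz_supp b.
exists [set u : rlz Q | 0 < u y]%classic; first by split=> //; exact: open_star.
pose S (e : rlz P) (u : rlz Q) := [set e' : rlz P | push e' = u /\
  exists x, [/\ q x = y, 0 < e x & 0 < e' x]]%classic.
(* By [SP], the default value [e] is not reached over the star of [y]. *)
pose s e u := xget e (S e u).
have SP (e : rlz P) (u : rlz Q) : 0 < push e y -> 0 < u y -> S e u (s e u).
  move=> /push_supp[x qx ex] uy.
  have [s1 Ks1 s1u] := rlz_simplex u.
  have xs1 : q x \in s1 by rewrite qx; exact: in_simplex_mem uy.
  have [s2 [Ks2 xs2 qi qs]] := chain_lift Ks1 xs1.
  have [t [_ tu pt]] := simplex_lift Ks2 qi qs s1u.
  apply: (xgetPex e); exists t; split=> //; exists x; split=> //.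
  by rewrite tu// qx.
have SU (e e1 : rlz P) : (exists x, [/\ q x = y, 0 < e x & 0 < e1 x]) ->
    s e (push e1) = e1.
  move=> [x [qx ex e1x]].
  have [||e2 [x' [qx' ex' e2x']]] := SP e (push e1).
  - by rewrite -qx push_gt0.
  - by rewrite -qx push_gt0.
  have xx' : x' = x by apply: chain_inj ex' ex _; rewrite qx qx'.
  by subst x'; exact: push_star_inj e2x' e1x.
exists s; split=> /=.
- by move=> e /push_supp[x qx ex]; apply: SU; exists x.
- by move=> e u ey uy; have [] := SP e u ey uy.
- move=> e ey; apply/subspace_continuousP => u0 /= u0y W.
  rewrite nbhsE => -[V [oV Vu0] VW].
  suff oG : open [set u : rlz Q | 0 < u y /\ V (s e u)]%classic.
    have : nbhs u0 [set u : rlz Q | 0 < u y /\ V (s e u)]%classic.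
      by apply: open_nbhs_nbhs; split.
    by apply: filterS => u [_ /VW].
  (* Openness is tested on each simplex [s1], over which the section takes values in a single lifted
     simplex [s2] and keeps the coordinates. *)
  rewrite rlz_openE => s1 Ks1 t s1t [ty Vt].
  have [x qx ex] := push_supp ey.
  have xs1 : q x \in s1 by rewrite qx; exact: in_simplex_mem ty.
  have [s2 [Ks2 xs2 qi qs]] := chain_lift Ks1 xs1.
  have lift (u : rlz Q) : in_simplex s1 u -> 0 < u y -> in_simplex s2 (s e u) /\
      forall z, z \in s2 -> s e u z = u (q z).
    move=> s1u uy; have [t' [s2t' t'u pt']] := simplex_lift Ks2 qi qs s1u.
    suff -> : s e u = t' by [].
    by rewrite -pt'; apply: SU; exists x; split=> //; rewrite t'u// qx.
  have [s2t tE] := lift _ s1t ty.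
  move: oV; rewrite rlz_openE => /(_ _ Ks2 _ s2t Vt)[eps eps0 epsV].
  (* The bound [t y] keeps [u] inside the star of [y]. *)
  exists (Num.min eps (t y)); first by rewrite lt_min eps0.
  move=> u s1u tu; have uy : 0 < u y.
    by have := tu y; rewrite lt_min => /andP[_]; rewrite ltr_norml => /andP[_];
      lra.
  split=> //; have [s2u uE] := lift _ s1u uy; apply: epsV => // z.
  have [zs|zNs] := boolP (z \in s2).
    by rewrite tE// uE//; have := tu (q z); rewrite lt_min => /andP[].
  have [_ t0 _] := s2t; have [_ u0' _] := s2u.
  by rewrite t0// u0'// subrr normr0.
- move=> e /push_supp[x qx ex].
  have := open_nbhs_nbhs (conj (open_star (x := x)) ex).
  by apply: filterS => e' /= e'x; apply: SU; exists x.
- move=> e e' u pee' ey uy see'.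
  have ey' : 0 < push e' y by rewrite -pee'.
  have [_ [x [qx ex sx]]] := SP e u ey uy.
  have [_ [x' [qx' ex' sx']]] := SP e' u ey' uy.
  rewrite see' in sx.
  have xx' : x = x' by apply: chain_inj sx sx' _; rewrite qx qx'.
  by subst x'; exact: push_star_inj ex ex'.
Qed.

End PosetCovering.

(** * Deck transformations *)

Lemma nbr_exists (G : graph) : graph_connected G -> has_edge G ->
  forall x : G, exists y, adj x y.
Proof.
move=> cG [a [b ab]] x; have [[s]] := cG x a;
  case: s => [/= /eqP ->|y s /= /andP[/andP[xy _] _]].
  by exists b.
by exists y.
Qed.

Section Deck.
Variables (G : graph) (v : G) (p : ucover2 v).
Implicit Types (x y z : p) (g h : pi12 v).
Local Notation pr := (uproj p).

Lemma lift_nbr x (b : G) : adj (pr x) b -> exists2 y, adj x y & pr y = b.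
Proof. by move=> xb; have [_ _ /(_ b xb)[y]] := (uproj_covering x).1;
  exists y. Qed.

Lemma adj2_inj x c c' y z : adj x c -> adj c y -> adj x c' -> adj c' z ->
  pr y = pr z -> y = z.
Proof.
move=> xc cy xc' c'z; have [_ iN _] := (uproj_covering x).2.
by apply: iN; rewrite inE; [exists c|exists c'].
Qed.

Lemma uproj_surj : graph_connected G -> forall b : G, exists x, pr x = b.
Proof.
move=> cG b; have [c] := cG v b.
have pc : path (@adj G) (pr (ubase p)) c by rewrite uproj_base walk_path.
have [y ly] := lift_end_exists pc; exists y.
by rewrite -(lift_end_proj ly) uproj_base walk_last.
Qed.

Lemma lift_end_rev x (s : seq G) y : lift_end x s y ->
  lift_end y (rev (belast (pr x) s)) x.
Proof.
move=> [l [pl <- <-]]; exists (rev (belast x l)); split.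
- by rewrite rev_path; apply: sub_path pl => a b; rewrite adj_sym.
- rewrite map_rev; congr rev; elim: l x {pl} => //= a l IHl x.
  by rewrite IHl.
- by case: l {pl} => //= a l; rewrite rev_cons last_rcons.
Qed.

Lemma lift_end_walk x y (phi : walk x y) : lift_end x (map pr phi) y.
Proof. by exists phi; rewrite walk_path walk_last. Qed.

Lemma deck_lift x y (c : walk v v) (phi : walk (ubase p) x) :
  lift_end (ubase p) (c ++ map pr phi) y -> deck (pi12_class c) x = y.
Proof.
move=> [l [pl lE ly]]; apply: deckE.
have lP : path (@adj p) (ubase p) l && (last (ubase p) l == y)
  by rewrite pl ly eqxx.
by exists c, phi, (Walk lP).
Qed.

Lemma deck_lift_end x g (c : walk v v) (phi : walk (ubase p) x) :
  pi12_class c = g -> lift_end (ubase p) (c ++ map pr phi) (deck g x).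
Proof.
move=> cg; have pc : path (@adj G) (pr (ubase p)) (c ++ map pr phi).
  have := walk_path (map_walk pr phi); have := walk_path c.
  by rewrite /= uproj_base cat_path walk_last => -> ->.
by have [y ly] := lift_end_exists pc; rewrite -cg (deck_lift ly).
Qed.

Lemma deck_base_lift y (c : walk v v) :
  lift_end (ubase p) c y -> deck (pi12_class c) (ubase p) = y.
Proof.
by move=> cy; apply: (@deck_lift _ _ c (nil_walk _)); rewrite /= cats0.
Qed.

Lemma deck_proj g x : pr (deck g x) = pr x.
Proof.
have [phi] := ucover_connected (ubase p) x.
have /lift_end_proj := deck_lift_end phi (pi12_reprK g).
have := last_map pr phi (ubase p); rewrite uproj_base walk_last => <-.
by rewrite last_cat walk_last.
Qed.

(** Once the edge is appended to a walk that reaches [x], [deck g y] is the end of the lift of that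
    edge from [deck g x]. *)
Lemma deck_adj g x y : adj x y -> adj (deck g x) (deck g y).
Proof.
move=> xy; have [phi] := ucover_connected (ubase p) x.
have dx := deck_lift_end phi (pi12_reprK g).
have [z xz zy] : exists2 z, adj (deck g x) z & pr z = pr y.
  by apply: lift_nbr; rewrite deck_proj; exact: ghom_adj.
have yP : path (@adj p) x [:: y] && (last x [:: y] == y) by rewrite /= xy eqxx.
suff -> : deck g y = z by [].
rewrite -(pi12_reprK g); apply: (@deck_lift _ _ _ (cat_walk phi (Walk yP))).
rewrite /= map_cat catA; apply/lift_end_cat; exists (deck g x) => //.
by exists [:: z]; rewrite /= xz zy.
Qed.

Lemma deck1 x : deck 1%g x = x.
Proof.
have [phi] := ucover_connected (ubase p) x.
by apply: (@deck_lift _ _ (nil_walk v) phi); exact: lift_end_walk.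
Qed.

(** The lifted walk that computes [deck h x] ends there, so it can serve as the walk that computes
    the action of [g] on [deck h x]. *)
Lemma deckM g h x : deck (g * h)%g x = deck g (deck h x).
Proof.
have [phi] := ucover_connected (ubase p) x.
have [l [pl lE lx]] := deck_lift_end phi (pi12_reprK h).
have lP : path (@adj p) (ubase p) l && (last (ubase p) l == deck h x)
  by rewrite pl lx eqxx.
have := deck_lift_end (Walk lP) (pi12_reprK g).
rewrite /= lE catA => e.
have -> : (g * h)%g = pi12_class (cat_walk (pi12_repr g) (pi12_repr h)) by [].
exact: (deck_lift (c := cat_walk (pi12_repr g) (pi12_repr h)) e).
Qed.

Lemma deckK g x : deck g^-1%g (deck g x) = x.
Proof. by rewrite -deckM mulVg deck1. Qed.

Lemma deckKV g x : deck g (deck g^-1%g x) = x.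
Proof. by rewrite -deckM mulgV deck1. Qed.

Lemma deck_inj g x y : deck g x = deck g y -> x = y.
Proof. by move/(congr1 (deck g^-1%g)); rewrite !deckK. Qed.

(** The class is that of the projected walk to [y] followed by the reverse of the projected walk to
    [x]. *)
Lemma deck_trans x y : pr x = pr y -> exists g, deck g x = y.
Proof.
move=> xy; have [phi] := ucover_connected (ubase p) x.
have [psi] := ucover_connected (ubase p) y.
have [c cE] : exists c : walk v v,
    steps c = map pr psi ++ rev (belast (pr (ubase p)) (map pr phi)).
  (* The base point projects to [v] by a propositional equality only, so the walk is built over an
     arbitrary [v'] before substitution. *)
  have H (v' a b : G) (e : v' = v) (ab : a = b) (w1 : walk v' a) (w2 : walk v'
    b) :
      exists c : walk v v, steps c = w1 ++ rev (belast v' w2).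
    by subst; exists (cat_walk w1 (rev_walk w2)).
  exact: (H _ _ _ (uproj_base p) (esym xy) (map_walk pr psi) (map_walk pr phi)).
exists (pi12_class c); apply: (deck_lift (phi := phi)); rewrite cE -catA.
apply/lift_end_cat; exists y; first exact: lift_end_walk.
have py : path (@adj G) (pr y) (rev (belast (pr (ubase p)) (map pr phi))).
  by have := walk_path (rev_walk (map_walk pr phi)); rewrite /= xy.
have [z yz] := lift_end_exists py.
apply/lift_end_cat; exists z => //.
have := lift_end_rev yz; rewrite -xy.
suff -> : rev (belast (pr x) (rev (belast (pr (ubase p)) (map pr phi)))) = map
  pr phi by [].
have : last (pr (ubase p)) (map pr phi) = pr x by rewrite last_map walk_last.
move: (map pr phi) (pr (ubase p)) => s a <-.
case: s a => //= b s a.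
by rewrite rev_cons belast_rcons rev_cons revK -lastI.
Qed.

(** A representative of [g] then has a closed lift, which is equivalent to the trivial walk in the
    universal cover; its projection is trivial as well. *)
Lemma deck_free g : deck g (ubase p) = ubase p -> g = 1%g.
Proof.
move=> gb; have := deck_lift_end (nil_walk (ubase p)) (pi12_reprK g).
rewrite gb /= cats0 => -[l [pl lE lb]].
have lP : path (@adj p) (ubase p) l && (last (ubase p) l == ubase p)
  by rewrite pl lb eqxx.
have lnil : walk_equiv (map_walk pr (Walk lP)) (map_walk pr (nil_walk (ubase
  p))).
  exact/map_walk_equiv/ucover_walk_equiv.
have H (v' : G) (e : v' = v) (w w0 : walk v' v') (c : walk v v) :
    steps w = c -> steps w0 = [::] -> walk_equiv w w0 -> pi12_class c = 1%g.
  subst => wc w00 ww0; apply/pi12_classP.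
  have -> : c = w by apply: val_inj.
  by have -> : nil_walk v = w0 by apply: val_inj.
rewrite -(pi12_reprK g).
exact: (H _ (uproj_base p) (map_walk pr (Walk lP)) (map_walk pr (nil_walk _)) _
  lE erefl lnil).
Qed.

Lemma deck_inj_group g h : deck g (ubase p) = deck h (ubase p) -> g = h.
Proof.
move=> gh; have : (h^-1 * g)%g = 1%g.
  by apply: deck_free; rewrite deckM gh deckK.
by move=> /(congr1 (fun k : pi12 v => (h * k)%g));
  rewrite mulgA mulgV mul1g mulg1.
Qed.

End Deck.

(** * Projection of equivariant multi-homomorphisms *)

Section Pi12Map.
Variables (G H : graph) (f : ghom G H) (v : G).

Lemma pi12_class_mul (c d : walk v v) :
  (pi12_class c * pi12_class d)%g = pi12_class (cat_walk c d).
Proof. exact: pi12_mulE. Qed.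

Lemma pi12_mapM (a b : pi12 v) :
  pi12_map f (a * b)%g = (pi12_map f a * pi12_map f b)%g.
Proof.
rewrite -(pi12_reprK a) -(pi12_reprK b);
  move: (pi12_repr a) (pi12_repr b) => c d.
rewrite pi12_class_mul !pi12_mapE; apply: esym; apply: etrans (pi12_mulE _ _) _.
by congr pi12_class; apply: val_inj; rewrite /= map_cat.
Qed.

Lemma pi12_map1 : pi12_map f (1%g : pi12 v) = 1%g.
Proof.
have -> : (1%g : pi12 v) = pi12_class (nil_walk v) by [].
by rewrite pi12_mapE; apply: congr1; apply: val_inj.
Qed.

Lemma pi12_mapV (a : pi12 v) : pi12_map f a^-1%g = (pi12_map f a)^-1%g.
Proof. by apply: (@mulgI _ (pi12_map f a));
  rewrite -pi12_mapM !mulgV pi12_map1. Qed.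

End Pi12Map.

Section ProjectMultihom.
Variables (G H : graph) (connG : graph_connected G) (edgeG : has_edge G).
Variables (f : ghom G H) (v : G) (pG : ucover2 v) (pH : ucover2 (f v)).
Local Notation PE := (equiv_multihom f pG pH).
Local Notation PB := (multihom G H).
Implicit Types (eta theta : PE) (x y : pG) (a b c : pH).

Lemma equiv_mhom_deck eta g x :
  eta (deck g x) = [set deck (pi12_map f g) a | a in eta x].
Proof. exact: asboolW (equiv_mhomP eta) g x. Qed.

Lemma equiv_mhom_nonempty eta x : exists a, eta x a.
Proof. exact: (asboolW (mhomP eta)).1. Qed.

Lemma equiv_mhom_adj eta x y a b : adj x y -> eta x a -> eta y b -> adj a b.
Proof. by move=> xy; exact: (asboolW (mhomP eta)).2. Qed.

Lemma equiv_mhom_leP eta theta :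
  (eta <= theta)%O <-> forall x, eta x `<=` theta x.
Proof. by rewrite leEsub; split=> [/multihom_leP//|h]; exact/multihom_leP. Qed.

Lemma equiv_mhom_ext eta theta :
  (forall x a, eta x a <-> theta x a) -> eta = theta.
Proof.
move=> e; do 2 apply: val_inj.
apply/funext => x; apply/funext => a; apply/propext; exact: e.
Qed.

Lemma cover_nbr x : exists y, adj x y.
Proof.
have [b xb] := nbr_exists connG edgeG (uproj pG x).
by have [y xy _] := lift_nbr xb; exists y.
Qed.

(** All of [eta x] is adjacent to one vertex [c], and the covering is injective on the neighbors of
    [c]. *)
Lemma equiv_mhom_inj eta x a b : eta x a -> eta x b ->
  uproj pH a = uproj pH b -> a = b.
Proof.
move=> ea eb; have [y xy] := cover_nbr x;
  have [c ec] := equiv_mhom_nonempty eta y.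
by apply: (@adj_inj _ _ _ c); rewrite adj_sym;
  [exact: equiv_mhom_adj xy ea ec|exact: equiv_mhom_adj xy eb ec].
Qed.

(** The union over all lifts of [z] avoids a choice; by [proj_funP] a single lift gives the same
    set. *)
Definition proj_fun eta (z : G) : set H :=
  [set d | exists x a, [/\ uproj pG x = z, eta x a & uproj pH a = d]].

(** Two vertices in one fibre differ by an element of [pi12 v], and [eta] is equivariant. *)
Lemma proj_funP eta x d :
  proj_fun eta (uproj pG x) d <-> exists2 a, eta x a & uproj pH a = d.
Proof.
split=> [[x' [a [xx' ea <-]]]|[a ea ad]]; last by exists x, a.
have [g gx] := deck_trans xx'; exists (deck (pi12_map f g) a).
  by rewrite -gx equiv_mhom_deck; exists a.
exact: deck_proj.
Qed.

Lemma proj_mhom_subproof eta : `[< is_multihom (proj_fun eta) >].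
Proof.
apply/asboolP; split.
  move=> z; have [x <-] := uproj_surj pG connG z.
  by have [a ea] := equiv_mhom_nonempty eta x; exists (uproj pH a); exists x, a.
move=> z z' zz' d d'; have [x xz] := uproj_surj pG connG z; subst z.
have [y xy yz] := lift_nbr zz'; subst z'.
move=> /proj_funP[a ea <-] /proj_funP[b eb <-].
by apply: ghom_adj; exact: equiv_mhom_adj xy ea eb.
Qed.

Definition proj_mhom eta : PB := MultiHom (proj_mhom_subproof eta).

Lemma proj_mhomP eta x d :
  proj_mhom eta (uproj pG x) d <-> exists2 a, eta x a & uproj pH a = d.
Proof. exact: proj_funP. Qed.

Lemma mhom_ext (zeta xi : PB) :
  (forall x d, zeta (uproj pG x) d <-> xi (uproj pG x) d) -> zeta = xi.
Proof.
move=> e; apply: val_inj; apply/funext => z; apply/funext => d; apply/propext.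
have [x <-] := uproj_surj pG connG z; exact: e.
Qed.

(** One inclusion suffices for equivariance: applied to the inverse of [g], it gives the other. *)
Lemma equiv_mhom_exists (eta : pG -> set pH) : is_multihom eta ->
  (forall g x a, eta x a -> eta (deck g x) (deck (pi12_map f g) a)) ->
  exists theta : PE, theta = eta :> (pG -> set pH).
Proof.
move=> mh eq; have mP : `[< is_multihom eta >] by apply/asboolP.
have eP : `[< is_equivariant (f := f) (MultiHom mP) >].
  apply/asboolP => g x; apply/seteqP; split=> a /=; last first.
    by move=> [b eb <-]; exact: eq.
  move=> ea; exists (deck (pi12_map f g)^-1%g a); last exact: deckKV.
  by have := eq g^-1%g _ _ ea; rewrite deckK pi12_mapV.
by exists (EquivMultiHom eP).
Qed.

Lemma proj_mhom_homo : {homo proj_mhom : eta theta / (eta <= theta)%O}.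
Proof.
move=> eta theta /equiv_mhom_leP le;
  apply/multihom_leP => z d [x [a [xz ea ad]]].
by exists x, a; split=> //; exact: le.
Qed.

Lemma proj_mhom_down eta (zeta : PB) : (zeta <= proj_mhom eta)%O ->
  exists2 theta, (theta <= eta)%O & proj_mhom theta = zeta.
Proof.
move=> /multihom_leP le.
pose th x := [set a | eta x a /\ zeta (uproj pG x) (uproj pH a)].
have [||theta thE] := @equiv_mhom_exists th.
- split=> [x|x y xy a b [ea _] [eb _]]; last exact: equiv_mhom_adj xy ea eb.
  have [d zd] := (asboolW (mhomP zeta)).1 (uproj pG x).
  by have /proj_mhomP[a ea ad] := le _ _ zd; exists a; split=> //; rewrite ad.
- move=> g x a [ea za]; split; last by rewrite !deck_proj.
  by rewrite equiv_mhom_deck; exists a.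
exists theta.
  by apply/equiv_mhom_leP => x a; rewrite thE => -[].
apply: mhom_ext => x d; split => [/proj_mhomP[a]|zd].
  by rewrite thE => -[_ za] <-.
have /proj_mhomP[a ea ad] := le _ _ zd.
by apply/proj_mhomP; exists a => //; rewrite thE; split=> //; rewrite ad.
Qed.

Lemma proj_mhom_down_inj eta theta theta' : (theta <= eta)%O ->
  (theta' <= eta)%O -> proj_mhom theta = proj_mhom theta' -> theta = theta'.
Proof.
have hsub (t t' : PE) x a : (t <= eta)%O -> (t' <= eta)%O ->
    proj_mhom t = proj_mhom t' -> t x a -> t' x a.
  move=> /equiv_mhom_leP le /equiv_mhom_leP le' e ta.
  have : proj_mhom t' (uproj pG x) (uproj pH a) by rewrite -e;
    apply/proj_mhomP; exists a.
  move=> /proj_mhomP[b tb ba].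
  by rewrite (equiv_mhom_inj (le _ _ ta) (le' _ _ tb) (esym ba)).
by move=> le le' e; apply: equiv_mhom_ext => x a; split; apply: hsub.
Qed.

(* The injectivity of the covering map on second neighborhoods makes the choice
   of the neighbor [y] and of [c] irrelevant. *)
Lemma mhom_up_indep eta (zeta : PB) x y y' a c c' :
  (proj_mhom eta <= zeta)%O -> zeta (uproj pG x) (uproj pH a) ->
  adj x y -> adj x y' -> eta y c -> eta y' c' -> adj a c -> adj a c'.
Proof.
move=> /multihom_leP le za xy xy' ec ec' ac.
have [e ee] := equiv_mhom_nonempty eta x.
have zc' : zeta (uproj pG y') (uproj pH c').
  by apply: le; apply/proj_mhomP; exists c'.
have ac' : adj (uproj pH c') (uproj pH a).
  by rewrite adj_sym; apply: (asboolW (mhomP zeta)).2 za zc'; exact: ghom_adj.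
have [a' c'a' a'a] := lift_nbr ac'.
suff <- : a' = a by rewrite adj_sym.
apply: (@adj2_inj _ _ _ e c' c) => //; try by rewrite adj_sym.
- exact: equiv_mhom_adj xy' ee ec'.
- exact: equiv_mhom_adj xy ee ec.
Qed.

(** The lift consists at [x] of the vertices over [zeta] that are adjacent to a value of [eta] at a
    neighbor of [x]; by [mhom_up_indep] they are adjacent to all such values. *)
Lemma proj_mhom_up eta (zeta : PB) : (proj_mhom eta <= zeta)%O ->
  exists2 theta, (eta <= theta)%O & proj_mhom theta = zeta.
Proof.
move=> lez; have /multihom_leP le := lez.
pose th x := [set a | zeta (uproj pG x) (uproj pH a) /\
  exists y c, [/\ adj x y, eta y c & adj a c]].
have etath x a : eta x a -> th x a.
  move=> ea; split; first by apply: le; apply/proj_mhomP; exists a.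
  have [y xy] := cover_nbr x; have [c ec] := equiv_mhom_nonempty eta y.
  by exists y, c; split=> //; exact: equiv_mhom_adj xy ea ec.
have thN x a y c : th x a -> adj x y -> eta y c -> adj a c.
  move=> [za [y' [c' [xy' ec' ac']]]] xy ec.
  exact: mhom_up_indep lez za xy' xy ec' ec ac'.
have [||theta thE] := @equiv_mhom_exists th.
- split=> [x|x y xy a b tha thb].
    by have [a ea] := equiv_mhom_nonempty eta x; exists a; exact: etath.
  have [e ee] := equiv_mhom_nonempty eta x;
    have [c ec] := equiv_mhom_nonempty eta y.
  have ac := thN _ _ _ _ tha xy ec.
  have be : adj b e by apply: thN thb _ ee; rewrite adj_sym.
  have ab : adj (uproj pH a) (uproj pH b).
    by apply: (asboolW (mhomP zeta)).2 tha.1 thb.1; exact: ghom_adj.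
  (* [b'] and [b] have the same projection and lie in the second neighborhood of [c], through [a]
     and [e] respectively, so they are equal. *)
  have [b' ab' b'b] := lift_nbr ab.
  suff <- : b' = b by [].
  apply: (@adj2_inj _ _ _ c a e) => //; try by rewrite adj_sym.
  by rewrite adj_sym; exact: equiv_mhom_adj xy ee ec.
- move=> g x a [za [y [c [xy ec ac]]]]; split; first by rewrite !deck_proj.
  exists (deck g y), (deck (pi12_map f g) c); split; try exact: deck_adj.
  by rewrite equiv_mhom_deck; exists c.
exists theta.
  by apply/equiv_mhom_leP => x a; rewrite thE; exact: etath.
apply: mhom_ext => x d; split => [/proj_mhomP[a]|zd].
  by rewrite thE => -[za _] <-.
have [y xy] := cover_nbr x; have [c ec] := equiv_mhom_nonempty eta y.
have cd : adj (uproj pH c) d.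
  have zc : zeta (uproj pG y) (uproj pH c) by apply: le; apply/proj_mhomP;
    exists c.
  by apply: (asboolW (mhomP zeta)).2 zc zd; apply: ghom_adj; rewrite adj_sym.
have [a ca ad] := lift_nbr cd; apply/proj_mhomP; exists a => //.
rewrite thE; split; first by rewrite ad.
by exists y, c; split=> //; rewrite adj_sym.
Qed.

(** The values of both lifts at [x] are neighbors of one value [c] of [eta]. *)
Lemma proj_mhom_up_inj eta theta theta' : (eta <= theta)%O ->
  (eta <= theta')%O -> proj_mhom theta = proj_mhom theta' -> theta = theta'.
Proof.
have hsub (t t' : PE) x a : (eta <= t)%O -> (eta <= t')%O ->
    proj_mhom t = proj_mhom t' -> t x a -> t' x a.
  move=> /equiv_mhom_leP le /equiv_mhom_leP le' e ta.
  have : proj_mhom t' (uproj pG x) (uproj pH a) by rewrite -e;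
    apply/proj_mhomP; exists a.
  move=> /proj_mhomP[b tb ba].
  have [y xy] := cover_nbr x; have [c ec] := equiv_mhom_nonempty eta y.
  suff -> : a = b by [].
  apply: (@adj_inj _ _ _ c) => //; rewrite adj_sym.
    exact: equiv_mhom_adj xy ta (le _ _ ec).
  exact: equiv_mhom_adj xy tb (le' _ _ ec).
by move=> le le' e; apply: equiv_mhom_ext => x a; split; apply: hsub.
Qed.

Lemma proj_mhom_covering : poset_covering proj_mhom.
Proof.
split; [exact: proj_mhom_homo| | |exact: proj_mhom_up_inj|
  exact: proj_mhom_down_inj].
- by move=> eta zeta /proj_mhom_up.
- by move=> eta zeta /proj_mhom_down.
Qed.

End ProjectMultihom.

(** * Zigzags and homotopies of graph homomorphisms *)

Lemma clos_rt_seq (T : Type) (r : T -> T -> Prop) x y : clos_refl_trans T r x y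
  ->
  exists n (u : nat -> T), [/\ u 0 = x, u n = y & forall i, (i < n)%N -> r (u
    i) (u i.+1)].
Proof.
move=> /(clos_rt_rt1n T r); elim=> {x y} [x|x y z xy _ [n [u [u0 un ur]]]].
  by exists 0, (fun=> x).
exists n.+1, (fun i => if i is j.+1 then u j else x); split=> // -[_|i] /=.
  by rewrite u0.
by rewrite ltnS => /ur.
Qed.

Lemma multiplicative_exists (A B : groupType) (j : A -> B) :
  {morph j : x y / (x * y)%g} ->
  exists j' : {multiplicative A -> B}, j' = j :> (A -> B).
Proof.
move=> jM.
by exists (HB.pack_for {multiplicative A -> B} j (isMultiplicative.Build A B j
  jM)).
Qed.

Section Joined.
Local Open Scope ring_scope.
Variables (R : realType) (X : topologicalType).

Definition joined (x y : X) : Prop := exists c : R -> X,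
  [/\ {within `[0, 1], continuous c}, c 0 = x & c 1 = y].

Lemma joined_refl x : joined x x.
Proof.
by exists (fun=> x); split=> //; apply/continuous_subspaceT => t;
  exact: cvg_cst.
Qed.

Lemma joined_trans x y z : joined x y -> joined y z -> joined x z.
Proof.
move=> [c [cc c0 c1]] [d [cd d0 d1]]; exists (concat c d).
by rewrite concat0 concat1; split=> //; apply: concat_continuous;
  rewrite // c1 d0.
Qed.

Lemma joined_component x y : joined x y -> connected_component [set: X] x y.
Proof.
move=> [c [cc c0 c1]]; exists (c @` `[0, 1]); last by exists 1; [exact: unit1|].
split=> //; first by exists 0; [exact: unit0|].
by apply: connected_continuous_connected => //; exact: unit_connected.
Qed.

End Joined.

(** * Translates of the lift, traces and zigzags *)

Section Translate.
Variables (G H : graph) (connG : graph_connected G) (edgeG : has_edge G).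
Variables (f : ghom G H) (v : G) (pG : ucover2 v) (pH : ucover2 (f v)).
Variable ft : based_lift f pG pH.
Local Notation PE := (equiv_multihom f pG pH).
Local Notation q := (@proj_mhom G H connG f v pG pH).
Local Notation vt := (ubase pG).
Local Notation wt := (ubase pH).
Implicit Types (eta theta : PE) (x y : pG) (a b c : pH) (g : pi12 (f v)).

Lemma proj_mhom_lift : q (equiv_multihom_of ft) = multihom_of f.
Proof.
apply: (mhom_ext (pG := pG) connG) => x d; split.
  by move=> /proj_mhomP[a -> <-]; rewrite lift_comm.
by move=> ->; apply/proj_mhomP; exists (ft x) => //; rewrite lift_comm.
Qed.

Lemma fiber_proj eta x a : q eta = multihom_of f -> eta x a ->
  uproj pH a = f (uproj pG x).
Proof.
move=> qe ea; have : q eta (uproj pG x) (uproj pH a) by apply/proj_mhomP;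
  exists a.
by rewrite qe.
Qed.

Lemma fiber_inj eta x a b : q eta = multihom_of f -> eta x a -> eta x b -> a =
  b.
Proof.
move=> qe ea eb; apply: (equiv_mhom_inj connG edgeG ea eb).
by rewrite (fiber_proj qe ea) (fiber_proj qe eb).
Qed.

Lemma fiber_base eta : q eta = multihom_of f -> exists g, eta vt (deck g wt).
Proof.
move=> qe; have [a ea] := equiv_mhom_nonempty eta vt.
have [|g ga] := @deck_trans _ _ pH wt a.
  by rewrite (fiber_proj qe ea) !uproj_base.
by exists g; rewrite ga.
Qed.

(** [eta] and the translate of [ft] by [g] both lie over [f] and agree at the base vertex;
    uniqueness of lifted neighbors propagates this along walks. *)
Lemma fiber_deck eta g : q eta = multihom_of f -> eta vt (deck g wt) ->
  forall x, eta x (deck g (ft x)).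
Proof.
move=> qe eg x; have [phi] := ucover_connected vt x.
rewrite -(walk_last phi).
suff ind (s : seq pG) z : path (@adj pG) z s -> eta z (deck g (ft z)) ->
    eta (last z s) (deck g (ft (last z s))).
  by apply: (ind _ _ (walk_path phi)); rewrite lift_base.
elim: s z => //= y s IHs z /andP[zy pys] ez.
apply: IHs => //; have [a ea] := equiv_mhom_nonempty eta y.
suff -> : deck g (ft y) = a by [].
apply: (@adj_inj _ _ _ (deck g (ft z))).
- by apply: deck_adj; exact: ghom_adj.
- exact: equiv_mhom_adj zy ez ea.
- by rewrite deck_proj lift_comm (fiber_proj qe ea).
Qed.

(** The value of [eta] at [deck h vt] is computed twice: by [fiber_deck] with the equivariance of
    [ft], and by the equivariance of [eta]. *)
Lemma fiber_commute eta g : q eta = multihom_of f -> eta vt (deck g wt) ->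
  forall h : pi12 v, (g * pi12_map f h)%g = (pi12_map f h * g)%g.
Proof.
move=> qe eg h; apply: (deck_inj_group (p := pH)); rewrite !deckM.
apply: (@fiber_inj eta (deck h vt)) => //; last first.
  by rewrite equiv_mhom_deck; exists (deck g wt).
rewrite -{1}(lift_base ft) -lift_equivariant; exact: fiber_deck.
Qed.

(** Commutation with the image of [pi12_map f] keeps the translates equivariant. *)
Lemma translate_exists g :
  (forall h : pi12 v, (g * pi12_map f h)%g = (pi12_map f h * g)%g) ->
  exists T : PE -> PE, forall eta x, T eta x = [set deck g a | a in eta x].
Proof.
move=> gC; suff : forall eta, exists theta : PE,
  theta = (fun x => [set deck g a | a in eta x]) :> (pG -> set pH).
  by move=> /choice[T TE]; exists T => eta x; rewrite TE.
move=> eta; apply: equiv_mhom_exists.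
- split=> [x|x y xy _ _ [a ea <-] [b eb <-]].
    by have [a ea] := equiv_mhom_nonempty eta x; exists (deck g a); exists a.
  by apply: deck_adj; exact: equiv_mhom_adj xy ea eb.
- move=> h x _ [a ea <-]; exists (deck (pi12_map f h) a).
    by rewrite equiv_mhom_deck; exists a.
  by rewrite -!deckM gC.
Qed.

(** Values [a i] of [u i] at [vt] and [b i] at a neighbor [y], chosen over the two rows of [h],
    alternate to form the lift of the trace; the upper bound of [u i] and [u i.+1] makes [b i]
    adjacent to [a i.+1]. *)
Lemma trace_lift n (h : xhomotopy f n) (u : nat -> PE) v' (vv' : adj v v') :
  u 0 = equiv_multihom_of ft ->
  (forall i, (i < n)%N -> exists2 theta, (u i <= theta)%O & (u i.+1 <=
    theta)%O) ->
  (forall i, (i <= n)%N -> forall z, q (u i) z (h (z, inord i))) ->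
  u n vt (deck (pi12_class (trace_walk h vv')) wt).
Proof.
move=> u0 ul uh.
have [y vy yv'] : exists2 y, adj vt y & uproj pG y = v'.
  by apply: lift_nbr; rewrite uproj_base.
have /choice[a aP] : forall i, exists a, (i <= n)%N ->
    u i vt a /\ uproj pH a = h (v, inord i).
  move=> i; case: (boolP (i <= n)%N) => [ni|_]; last by exists wt.
  have : q (u i) (uproj pG vt) (h (v, inord i)) by rewrite uproj_base;
    exact: uh.
  by move=> /proj_mhomP[a ea ha]; exists a.
have /choice[b bP] : forall i, exists b, (i <= n)%N ->
    u i y b /\ uproj pH b = h (v', inord i).
  move=> i; case: (boolP (i <= n)%N) => [ni|_]; last by exists wt.
  have : q (u i) (uproj pG y) (h (v', inord i)) by rewrite yv'; exact: uh.
  by move=> /proj_mhomP[b eb hb]; exists b.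
(* At the start the choice is forced, so the lift begins at the base point. *)
have a0 : a 0 = wt.
  by have [+ _] := aP 0 (leq0n n); rewrite u0 => ->; rewrite lift_base.
suff : lift_end wt (trace v h v') (a n).
  by move=> /(deck_base_lift (c := trace_walk h vv')) ->;
    have [] := aP n (leqnn n).
rewrite -a0 /trace.
suff H' : forall k m, (m + k = n)%N -> lift_end (a m)
    (flatten [seq [:: h (v', inord i);
      h (v, inord i.+1)] | i <- iota m k]) (a n).
  exact: H'.
elim=> [|k IHk] m mkn.
  by rewrite addn0 in mkn; rewrite mkn; exists [::].
have mn : (m < n)%N by rewrite -mkn -addSnnS leq_addr.
have [uam ham] := aP m (ltnW mn); have [ubm hbm] := bP m (ltnW mn).
have [uam' ham'] := aP m.+1 mn.
have [theta /equiv_mhom_leP le /equiv_mhom_leP le'] := ul m mn.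
rewrite /=; apply/(lift_end_cat _ [:: _; _]); exists (a m.+1); last first.
  by apply: IHk; rewrite addSnnS.
exists [:: b m; a m.+1]; rewrite /= hbm ham' andbT; split=> //.
apply/andP; split; first exact: equiv_mhom_adj vy uam ubm.
by rewrite adj_sym; exact: equiv_mhom_adj vy (le' _ _ uam') (le _ _ ubm).
Qed.

(** Any choice of a vertex in each [q (u i) z] works: consecutive terms have an upper bound, which
    is a multi-homomorphism and yields the adjacencies. At both ends [q (u i)] is [f], so the choice
    is forced. *)
Lemma zigzag_xhomotopy n (u : nat -> PE) :
  q (u 0) = multihom_of f -> q (u n) = multihom_of f ->
  (forall i, (i < n)%N -> (u i >=< u i.+1)%O) ->
  exists h : xhomotopy f n,
    forall i, (i <= n)%N -> forall z, q (u i) z (h (z, inord i)).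
Proof.
move=> q0 qn uc.
have /choice[k kP] : forall z : G * nat, exists d, q (u z.2) z.1 d.
  by move=> [z i]; exact: (asboolW (mhomP (q (u i)))).1.
have up i j : (i <= n)%N -> (j <= n)%N -> (i <= j.+1)%N -> (j <= i.+1)%N ->
    exists2 theta, (u i <= theta)%O & (u j <= theta)%O.
  wlog ij : i j / (i <= j)%N.
    move=> W; case/orP: (leq_total i j) => ij hi hj h1 h2; first exact: W.
    by have [theta ? ?] := W j i ij hj hi h2 h1; exists theta.
  move=> hi hj _; rewrite leq_eqVlt => /orP[/eqP ji|ji].
    have /orP[le|le] : (u i >=< u j)%O by rewrite ji; apply: uc; rewrite -ji.
      by exists (u j); [exact: le|exact: lexx].
    by exists (u i); [exact: lexx|exact: le].
  have -> : j = i by apply/eqP; rewrite eqn_leq ij -ltnS ji.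
  by exists (u i).
pose hf (z : prod_graph G (interval_graph n)) : H := k (z.1, nat_of_ord z.2).
have hadj z z' : adj z z' -> adj (hf z) (hf z').
  move: z z' => [z i] [z' j] /= /andP[/= zz' /andP[/= ij ji]].
  have [theta le le'] := up i j (ltn_ord i) (ltn_ord j) ij ji.
  have /multihom_leP qle := proj_mhom_homo connG le.
  have /multihom_leP qle' := proj_mhom_homo connG le'.
  apply: (asboolW (mhomP (q theta))).2 zz' _ _ _ _.
    exact: qle (kP (z, nat_of_ord i)).
  exact: qle' (kP (z', nat_of_ord j)).
have h0 z : GHom hadj (z, ord0) = f z.
  by have : q (u 0) z (k (z, 0)) := kP (z, 0); rewrite q0.
have h1 z : GHom hadj (z, ord_max) = f z.
  by have : q (u n) z (k (z, n)) := kP (z, n); rewrite qn.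
exists (XHomotopy h0 h1) => i ni z /=; rewrite /hf /= inordK//.
exact: kP (z, i).
Qed.

(** Between stages [i] and [i.+1] the zigzag goes up to the union of the two homomorphisms and down
    again; both moves lift through [q]. *)
Lemma xhomotopy_zigzag n (h : xhomotopy f n) : exists u : nat -> PE,
  [/\ u 0 = equiv_multihom_of ft,
   forall i, (i < n)%N -> exists2 theta, (u i <= theta)%O & (u i.+1 <= theta)%O
     &
   forall i, (i <= n)%N -> forall z, q (u i) z = [set h (z, inord i)]].
Proof.
pose hh i z : H := h (z, inord i).
have hadj i j : (i <= n)%N -> (j <= n)%N -> (i <= j.+1)%N -> (j <= i.+1)%N ->
    forall z z', adj z z' -> adj (hh i z) (hh j z').
  move=> ni nj ij ji z z' zz'; apply: ghom_adj.
  by rewrite /= zz' !inordK// ij ji.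
(* When the premises fail any [eta'] will do; this makes the step total, so that choice yields a
   function [S] to iterate. *)
have step (z : nat * PE) : exists eta', (z.1 < n)%N ->
    (forall x : G, q z.2 x = [set hh z.1 x]) ->
    (exists2 theta, (z.2 <= theta)%O & (eta' <= theta)%O) /\
    forall x : G, q eta' x = [set hh z.1.+1 x].
  case: z => i eta /=; have [ni|_] := boolP (i < n)%N; last by exists eta.
  have [qe|] := pselect (forall x : G, q eta x = [set hh i x]);
    last by exists eta.
  (* The union is a multi-homomorphism because [i] and [i.+1] are adjacent to themselves and to each
     other in the interval graph. *)
  have mP : `[< is_multihom (fun x : G => [set hh i x; hh i.+1 x]) >].
    apply/asboolP; split=> [x|x y xy a b].
      by exists (hh i x); left.
    by move=> [->|->] [->|->]; apply: hadj => //; exact: ltnW.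
  have mP' : `[< is_multihom (fun x : G => [set hh i.+1 x]) >].
    apply/asboolP; split=> [x|x y xy a b -> ->]; first by exists (hh i.+1 x).
    by apply: hadj.
  have le1 : (q eta <= MultiHom mP)%O.
    by apply/multihom_leP => x; rewrite qe => d ->; left.
  have [theta le_ qt] := proj_mhom_up edgeG le1.
  have le2 : (MultiHom mP' <= q theta)%O.
    by rewrite qt; apply/multihom_leP => x d /= ->; right.
  have [eta' le' qe'] := proj_mhom_down le2.
  exists eta' => _ _; split; first by exists theta.
  by move=> x; exact: (congr1 (fun m : multihom G H => mhom_fun m x) qe').
have /choice[S SP] := step.
pose u i := nat_rect (fun=> PE) (equiv_multihom_of ft) (fun i eta => S (i,
  eta)) i.
have uq : forall i, (i <= n)%N -> forall x : G, q (u i) x = [set hh i x].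
  elim=> [_ x|i IHi ni].
    rewrite [mhom_fun _ _](congr1 (fun m : multihom G H => mhom_fun m x)
      proj_mhom_lift).
    rewrite /= /hh; congr [set _].
    by rewrite -(xhom_start h); congr (h (_, _)); apply: val_inj;
      rewrite /= inordK.
  exact: (SP (i, u i) ni (IHi (ltnW ni))).2.
exists u; split=> // i ni.
exact: (SP (i, u i) ni (uq i (ltnW ni))).1.
Qed.

End Translate.

(** * Monodromy *)

Section Monodromy.
Variables (R : realType) (G H : graph).
Variables (connG : graph_connected G) (edgeG : has_edge G).
Variables (f : ghom G H) (v : G) (pG : ucover2 v) (pH : ucover2 (f v)).
Variable ft : based_lift f pG pH.
Local Notation PE := (equiv_multihom f pG pH).
Local Notation PB := (multihom G H).
Local Notation q := (@proj_mhom G H connG f v pG pH).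
Local Notation vt := (ubase pG).
Local Notation wt := (ubase pH).
Local Notation E := (realization R (@order_complex _ PE)).
Local Notation B := (realization R (@order_complex _ PB)).
Local Notation e0 := (order_complex_point R (equiv_multihom_of ft)).
Local Notation b0 := (order_complex_point R (multihom_of f)).

Local Notation qcov := (@proj_mhom_covering G H connG edgeG f v pG pH).
Local Notation p := (push (poset_covering_homo qcov) : E -> B).

Lemma hom_covering_map : covering_map p.
Proof. exact: push_covering_map. Qed.

Local Notation pcov := hom_covering_map.

Lemma hom_covering_base : p e0 = b0.
Proof. by rewrite push_pt proj_mhom_lift. Qed.

Local Notation pe0 := hom_covering_base.

Local Notation mono := (monodromy p e0 (b0 := b0)).

(** The graph of the map [j]: the lift of [a] ends at the translate of [ft] by [g], which is read
    off at the base vertex. *)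
Definition monodromy_label (a : hom_pi1 R f) (g : pi12 (f v)) : Prop :=
  exists eta : PE, [/\ mono a (order_complex_point R eta),
    q eta = multihom_of f & eta vt (deck g wt)].

(** The lift ends over the vertex [b0], and points over a vertex are vertices. *)
Lemma monodromy_label_exists a : exists g, monodromy_label a g.
Proof.
have [e ae] := monodromy_exists pcov pe0 a.
have /push_fiber[eta qe ee] := monodromy_proj ae.
have [g eg] := fiber_base qe.
by exists g, eta; rewrite -ee.
Qed.

Lemma monodromy_label_inj a g g' :
  monodromy_label a g -> monodromy_label a g' -> g = g'.
Proof.
move=> [eta [ae qe eg]] [eta' [ae' _ eg']].
have ee : eta = eta' by apply: pt_inj; exact: (monodromy_inj pcov pe0 ae ae').
subst eta'; apply: (deck_inj_group (p := pH)).
exact: (fiber_inj edgeG qe eg eg').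
Qed.

Lemma fiber_singleton (eta : PE) g : q eta = multihom_of f ->
  eta vt (deck g wt) -> forall x, eta x = [set deck g (ft x)].
Proof.
move=> qe eg x; have ex := fiber_deck ft qe eg x.
by apply/seteqP; split=> [a ea|a ->//]; exact: (fiber_inj edgeG qe ea ex).
Qed.

(** [g] commutes with the image of [pi12_map f], so translation by [g] acts on the realization over
    the base and moves [e0] to the end of the lift of [a]; the lift of the product ends at the
    translate of [theta]. *)
Lemma monodromy_labelM a b g h : monodromy_label a g -> monodromy_label b h ->
  monodromy_label (a * b)%g (g * h)%g.
Proof.
move=> [eta [ae qe eg]] [theta [bt qt th]].
have gC := fiber_commute edgeG ft qe eg.
have [T TE] := translate_exists pG pH gC.
have Tmono : {homo T : x y / (x <= y)%O}.
  move=> x y /equiv_mhom_leP xy; apply/equiv_mhom_leP => z c.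
  by rewrite !TE => -[d /xy yd <-]; exists d.
have Tinj : injective T.
  move=> x y xy; apply: equiv_mhom_ext => z c.
  have xyz : T x z = T y z by rewrite xy.
  move: xyz; rewrite !TE => /seteqP[s1 s2]; split=> xc.
    by have [|d yd /deck_inj <-] := s1 (deck g c); first by exists c.
  by have [|d yd /deck_inj <-] := s2 (deck g c); first by exists c.
have qT x : q (T x) = q x.
  apply: (mhom_ext (pG := pG) connG) => z c; split=> /proj_mhomP[d].
    rewrite TE => -[d' xd' <-] <-; apply/proj_mhomP; exists d' => //.
    by rewrite deck_proj.
  move=> xd <-; apply/proj_mhomP; exists (deck g d); last by rewrite deck_proj.
  by rewrite TE; exists d.
have Te0 : push Tmono e0 = order_complex_point R eta.
  rewrite push_pt; congr order_complex_point; apply: equiv_mhom_ext => x c.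
  have fE : equiv_multihom_of ft x = [set ft x] by [].
  by rewrite TE fE image_set1 (fiber_singleton qe eg).
exists (T theta); split.
- rewrite -(push_pt R Tmono).
  apply: (monodromy_mul pcov pe0 _ _ Te0 ae bt).
    exact: push_continuous.
  by move=> t; exact: push_comp.
- by rewrite qT.
- by rewrite TE deckM; exists (deck h wt).
Qed.

(** This identifies the kernel of [j] with the classes of loops whose lift is closed, the image
    found in [covering_pi1]. *)
Lemma monodromy_label1 a : monodromy_label a 1%g <-> mono a e0.
Proof.
split=> [[eta [ae qe e1]]|a0].
  suff ee : eta = equiv_multihom_of ft by rewrite ee in ae.
  apply: equiv_mhom_ext => x c.
  by rewrite (fiber_singleton qe e1) deck1.
exists (equiv_multihom_of ft); split=> //; first exact: proj_mhom_lift.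
by rewrite deck1 /= lift_base.
Qed.

(** The lifted loop joins [e0] to the vertex [eta], hence a zigzag does; the trace of the resulting
    x-homotopy lifts to a walk that ends at [deck g wt]. *)
Lemma monodromy_label_realizable a g : monodromy_label a g -> realizable f v g.
Proof.
move=> [eta [ae qe eg]].
have [c' [cc' _ c'0 c'1]] := ae.
have j01 : joined R e0 (order_complex_point R eta) by exists c'.
have [n [u [u0 un uc]]] := clos_rt_seq (component_zigzag (joined_component
  j01)).
have [||//|h hq] := @zigzag_xhomotopy G H connG f v pG pH n u.
- by rewrite u0 proj_mhom_lift.
- by rewrite un.
have [v' vv'] := nbr_exists connG edgeG v.
exists n, h, v', vv'.
have ul i : (i < n)%N -> exists2 theta, (u i <= theta)%O & (u i.+1 <= theta)%O.
  move=> /uc/orP[le|le]; first by exists (u i.+1); [exact: le|exact: lexx].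
  by exists (u i); [exact: lexx|exact: le].
have := trace_lift vv' u0 ul hq; rewrite un => et.
exact/(deck_inj_group (p := pH))/(fiber_inj edgeG qe et eg).
Qed.

(** The x-homotopy lifts to a zigzag, which gives a path of edges in the realization; the projection
    of that path is the loop. *)
Lemma realizable_monodromy_label g : realizable f v g ->
  exists a, monodromy_label a g.
Proof.
move=> [n [h [v' [vv' <-]]]].
have [u [u0 ul uq]] := xhomotopy_zigzag connG edgeG ft h.
have qn : q (u n) = multihom_of f.
  apply: (mhom_ext (pG := pG) connG) => x d.
  rewrite uq //= (_ : inord n = ord_max) ?xhom_end//.
  by apply: val_inj; rewrite /= inordK.
have step (x y : PE) : (x <= y)%O ->
    joined R (order_complex_point R x) (order_complex_point R y) /\
    joined R (order_complex_point R y) (order_complex_point R x).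
  move=> xy; have c : (x >=< y)%O by rewrite /Order.comparable xy.
  by split; apply: pt_path => //; rewrite comparable_sym.
have : joined R e0 (order_complex_point R (u n)).
  suff H' i : (i <= n)%N -> joined R e0 (order_complex_point R (u i))
    by exact: H'.
  elim: i => [_|i IHi ni]; first by rewrite u0; exact: joined_refl.
  have [theta le le'] := ul i ni.
  apply: joined_trans (IHi (ltnW ni)) _.
  exact: joined_trans (step _ _ le).1 (step _ _ le').2.
move=> [c [cc c0 c1]].
have [|a] := monodromy_of_path pcov pe0 cc c0.
  by rewrite c1 push_pt qn.
rewrite c1 => ac; exists a, (u n); split=> //.
by apply: (trace_lift (connG := connG) vv' u0 ul) => i ni z; rewrite uq.
Qed.

End Monodromy.

(** * Assembly of the short exact sequence *)

Theorem theorem1p5 (R : realType) (G H : graph)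
    (finG : finite_graph G) (finH : finite_graph H)
    (connG : graph_connected G) (connH : graph_connected H)
    (edgeG : has_edge G) (edgeH : has_edge H)
    (f : ghom G H) (v : G)
    (pG : ucover2 v) (pH : ucover2 (f v)) (ft : based_lift f pG pH) :
  exists (i : {multiplicative equiv_hom_pi1 R ft -> hom_pi1 R f})
         (j : {multiplicative hom_pi1 R f -> pi12 (f v)}),
    short_exact (realizable f v) i j.
Proof.
have /choice[j0 jP] := monodromy_label_exists connG edgeG ft (R := R).
have jE a g : monodromy_label connG edgeG ft a g -> j0 a = g.
  exact: monodromy_label_inj.
have [|j jj0] := @multiplicative_exists _ _ j0.
  by move=> a b; apply: jE; exact: monodromy_labelM.
have [i [iinj ir]] := covering_pi1 R (hom_covering_map R connG edgeG pG pH)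
  (hom_covering_base R connG edgeG ft).
exists i, j; split=> //.
- rewrite ir; apply/seteqP; split=> a /=; rewrite jj0.
    by move=> a0; apply: jE; apply/monodromy_label1.
  by move=> ja; have := jP a; rewrite ja => /monodromy_label1.
- rewrite jj0; apply/seteqP; split=> [_ [a _ <-]|g].
    exact: monodromy_label_realizable (jP a).
  by move=> /(realizable_monodromy_label R connG edgeG ft)[a /jE <-]; exists a.
Qed.
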